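(* Let $\mu$ be a finitely supported probability measure on $G=\mathrm{Aut}(\mathbb{A}^2_{\mathbb{C}})$ which is non-elementary and purely loxodromic. If $\nu$ is a $\mu$-stationary Borel probability measure on $\mathbb{C}^2$, then $\nu$ is compactly supported.
   Context: $G$ is the group of polynomial automorphisms of the affine plane $\mathbb{A}^2_{\mathbb{C}}$, acting on $\mathbb{C}^2$. $E\subset G$ is the elementary group of maps $(x,y)\mapsto(\alpha x+p(y),\beta y+\delta)$ with $\alpha\beta\neq0$, $p\in\mathbb{C}[y]$. An element of $G$ is loxodromic if it is not conjugate in $G$ to any element of $E$. For a finitely supported probability measure $\mu$ on $G$, $\Sigma_\mu$ is its support and $\Gamma_\mu=\langle\Sigma_\mu\rangle$ is the group generated by the support. $\mu$ is non-elementary if $\Gamma_\mu$ contains two loxodromic elements generating a free group of rank two; $\mu$ is purely loxodromic if every element of $\Gamma_\mu\setminus\{1\}$ is loxodromic. A Borel probability measure $\nu$ on $\mathbb{C}^2$ is $\mu$-stationary if $\sum_{f\in\Sigma_\mu}\mu(f)f_*\nu=\nu$. *)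

(* Defs.v *)
From HB Require Import structures.
From mathcomp Require Import all_boot all_order all_algebra.
From mathcomp Require Import complex polyXY.
From mathcomp Require Import all_classical all_reals all_analysis.

Set Implicit Arguments.
Unset Strict Implicit.
Unset Printing Implicit Defensive.

Import Order.TTheory GRing.Theory Num.Theory.
Import numFieldNormedType.Exports.

Local Open Scope classical_set_scope.
Local Open Scope ring_scope.

(* The ascription to [numClosedFieldType] is what makes the norm topology of
   the field R[i] inferable; [R[i]] itself carries no topology. *)
Definition cplx (R : realType) : numClosedFieldType := R[i].

(* C^2 with the product topology. *)
Notation plane R := (cplx R * cplx R)%type.

(* C^2 with its Borel sigma-algebra. *)
Notation borel_plane R := (g_sigma_algebraType (@open (plane R))).

Section Aut.
Variable R : realType.

Definition polynomial_map (f : plane R -> plane R) :=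
  exists P Q : {poly {poly cplx R}},
    forall x y, f (x, y) = (P.[x, y], Q.[x, y]).

(* Since C is infinite, a polynomial automorphism of the affine plane over C
   is determined by the bijection that it induces on C^2. The field [aut_inv]
   is determined by [aut_fun] (see [polyaut_inj]). *)
Record polyaut := PolyAut {
  aut_fun :> plane R -> plane R;
  aut_inv : plane R -> plane R;
  aut_funP : polynomial_map aut_fun;
  aut_invP : polynomial_map aut_inv;
  aut_funK : cancel aut_fun aut_inv;
  aut_invK : cancel aut_inv aut_fun
}.

Lemma polyaut_inj (f g : polyaut) : aut_fun f =1 aut_fun g -> f = g.
Proof.
case: f g => [f f' Pf Pf' fK f'K] [g g' Pg Pg' gK g'K] /= fg.
have {fg} efg : f = g by apply/funext.
subst g.
have e : f' = g' by apply/funext => z; rewrite -{1}(g'K z) fK.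
by subst g'; congr PolyAut; exact: Prop_irrelevance.
Qed.

HB.instance Definition _ := gen_eqMixin polyaut.
HB.instance Definition _ := gen_choiceMixin polyaut.

Lemma polynomial_map_id : polynomial_map id.
Proof.
by exists 'X, 'Y => x y; rewrite !(hornerX, hornerC).
Qed.

Lemma poly_comp2 (P Q S : {poly {poly cplx R}}) :
  exists T : {poly {poly cplx R}},
    forall x y, T.[x, y] = S.[P.[x, y], Q.[x, y]].
Proof.
elim/poly_ind: S => [|S c [T hT]].
  by exists 0 => x y; rewrite !horner0.
have [U hU] : exists U : {poly {poly cplx R}},
    forall x y, U.[x, y] = c.[Q.[x, y]].
  elim/poly_ind: c => [|c a [U hU]].
    by exists 0 => x y; rewrite !horner0.
  exists (U * Q + a%:P%:P) => x y.
  by rewrite !(hornerD, hornerM, hornerX, hornerC) hU.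
exists (T * P + U) => x y.
by rewrite !(hornerD, hornerM, hornerX, hornerC) hT hU.
Qed.

Lemma polynomial_map_comp (f g : plane R -> plane R) :
  polynomial_map f -> polynomial_map g -> polynomial_map (f \o g).
Proof.
move=> [P [Q fE]] [P' [Q' gE]].
have [T hT] := poly_comp2 P' Q' P; have [U hU] := poly_comp2 P' Q' Q.
by exists T, U => x y; rewrite /= gE fE hT hU.
Qed.

Definition aut_one : polyaut :=
  PolyAut polynomial_map_id polynomial_map_id (fun=> erefl) (fun=> erefl).

Definition aut_comp (f g : polyaut) : polyaut :=
  PolyAut (polynomial_map_comp (aut_funP f) (aut_funP g))
    (polynomial_map_comp (aut_invP g) (aut_invP f))
    (can_comp (@aut_funK f) (@aut_funK g))
    (can_comp (@aut_invK g) (@aut_invK f)).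

Definition aut_rev (f : polyaut) : polyaut :=
  PolyAut (aut_invP f) (aut_funP f) (@aut_invK f) (@aut_funK f).

Fact aut_compA : associative aut_comp.
Proof. by move=> f g h; apply: polyaut_inj. Qed.
Fact aut_comp1f : left_id aut_one aut_comp.
Proof. by move=> f; apply: polyaut_inj. Qed.
Fact aut_compf1 : right_id aut_one aut_comp.
Proof. by move=> f; apply: polyaut_inj. Qed.
Fact aut_compVf : left_inverse aut_one aut_rev aut_comp.
Proof. by move=> f; apply: polyaut_inj => z; exact: aut_funK. Qed.
Fact aut_compfV : right_inverse aut_one aut_rev aut_comp.
Proof. by move=> f; apply: polyaut_inj => z; exact: aut_invK. Qed.

HB.instance Definition _ := isGroup.Build polyaut
  aut_compA aut_comp1f aut_compf1 aut_compVf aut_compfV.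

Definition elementary (f : polyaut) :=
  exists (a b d : cplx R) (p : {poly cplx R}),
    a * b != 0 /\ forall x y, f (x, y) = (a * x + p.[y], b * y + d).

Definition loxodromic (f : polyaut) :=
  forall g : polyaut, ~ elementary (f ^ g)%g.

End Aut.

Section Groups.
Variable G : groupType.

Definition generated (S : set G) : set G :=
  smallest (fun H : set G => group_closed [in H]) S.

(* A letter (s, e) stands for b if s holds and for a otherwise, inverted
   when e holds. *)
Definition letter (a b : G) (l : bool * bool) : G :=
  let x := if l.1 then b else a in (if l.2 then x^-1 else x)%g.

Definition reduced (w : seq (bool * bool)) : bool :=
  sorted (fun l m => ~~ ((l.1 == m.1) && (l.2 != m.2))) w.

Definition free_pair (a b : G) :=
  forall w, reduced w -> w != [::] -> (\prod_(l <- w) letter a b l)%g <> 1%g.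

Definition free_rank2 (H : set G) :=
  exists a b : G, H = generated [set a; b] /\ free_pair a b.

End Groups.

Section RandomWalk.
Variable R : realType.
Implicit Types (mu : polyaut R -> R) (nu : probability (borel_plane R) R).

Definition msupp mu : set (polyaut R) := [set f | mu f != 0].

(* A finitely supported probability measure on the group of automorphisms,
   given by the masses of its atoms. *)
Definition finitely_supported_probability mu :=
  [/\ forall f, 0 <= mu f, finite_set (msupp mu)
    & \sum_(f \in msupp mu) mu f = 1].

Definition Gamma mu : set (polyaut R) := generated (msupp mu).

Definition non_elementary mu :=
  exists f g : polyaut R,
    [/\ Gamma mu f, Gamma mu g, loxodromic f, loxodromic g
      & free_rank2 (generated [set f; g])].

Definition purely_loxodromic mu :=
  forall f : polyaut R, Gamma mu f -> f <> 1%g -> loxodromic f.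

Definition stationary mu nu :=
  forall A : set (borel_plane R), measurable A ->
    (\sum_(f \in msupp mu) (mu f)%:E *
       pushforward nu (f : borel_plane R -> borel_plane R) A)%E = nu A.

Definition measure_support nu : set (plane R) :=
  [set z | forall U : set (plane R), open U -> U z -> (0 < nu U)%E].

Definition compactly_supported nu := compact (measure_support nu).

End RandomWalk.

(* Main.v *)
(* The group Gamma acts on the Bass-Serre tree of Aut(A^2) = A *_{A n E} E, where
   A is the affine and E the elementary group, and being purely loxodromic it
   acts freely. Hence a finitely generated Gamma preserves a connected subgraph
   that is locally finite with finite quotient, and there are finitely many
   transition maps between charts y^-1 z along its edges y. At a vertex yA where
   the chart of z is large, z escapes to infinity along every edge except at most
   one, by the ping-pong estimates for elementary and affine maps.

   Let nu be stationary. By the maximum principle, almost all of nu lies in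
   g (box) for infinitely many g in Gamma, so at each vertex there is a direction
   along which nu-almost no point escapes. If some vertex has two such directions,
   almost every z is bounded in its chart, and nu has compact support. Otherwise
   the unique directions form a Gamma-invariant flow on the graph; any two flow
   lines merge, so that Gamma acts on far flow lines by commuting shifts and every
   commutator fixes a vertex. By freeness Gamma would be abelian, whereas it
   contains a free group of rank two. *)
Require Import Defs.
From HB Require Import structures.
From mathcomp Require Import all_boot all_order all_algebra.
From mathcomp Require Import complex polyXY.
From mathcomp Require Import all_classical all_reals all_analysis.
From mathcomp Require Import finmap ring lra zify.
Import numFieldNormedType.Exports.
Set Implicit Arguments.
Unset Strict Implicit.
Unset Printing Implicit Defensive.
Import Order.TTheory GRing.Theory Num.Theory.
Local Open Scope classical_set_scope.
Local Open Scope ring_scope.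
(** * Left cosets and walks *)

Section Cosets.
Local Open Scope group_scope.
Variable G : groupType.
Implicit Types (H A E Y S : set G) (x y z g : G).

Definition is_subgroup H :=
  [/\ H 1, forall x, H x -> H x^-1 & forall x y, H x -> H y -> H (x * y)].

Lemma is_subgroupP H : group_closed [in H] <-> is_subgroup H.
Proof.
split=> [cH|[H1 HV HM]].
  split=> [|x Hx|x y Hx Hy]; apply: set_mem.
  - exact: cH.1.
  - by apply: (group_closedV cH); exact: mem_set.
  - by apply: (group_closedM cH); exact: mem_set.
split=> [|x y /set_mem Hx /set_mem Hy]; apply: mem_set => //.
by apply: HM => //; exact: HV.
Qed.

Lemma generated_is_subgroup S : is_subgroup (generated S).
Proof.
split=> [H [/is_subgroupP[H1 HV HM] SH]|x gx H|x y gx gy H] //.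
  by case=> /[dup] cH /is_subgroupP[_ HV _] SH; apply: HV; exact: gx.
by case=> /[dup] cH /is_subgroupP[_ _ HM] SH; apply: HM; [exact: gx|exact: gy].
Qed.

Lemma generated_min S H : is_subgroup H -> S `<=` H -> generated S `<=` H.
Proof. by move=> /is_subgroupP sH SH x; exact. Qed.

(* With A the affine and E the elementary group, the classes of [lcong A] and
   of [lcong E] are the vertices of the Bass-Serre tree of Aut(A^2), and an
   element x is the edge joining xA to xE. *)
Definition lcong H x y := H (x^-1 * y).

Lemma lcong_refl H x : is_subgroup H -> lcong H x x.
Proof. by case=> H1 _ _; rewrite /lcong mulVg. Qed.

Lemma lcong_sym H x y : is_subgroup H -> lcong H x y -> lcong H y x.
Proof. by case=> _ HV _ /HV; rewrite /lcong invgM invgK. Qed.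

Lemma lcong_trans H y x z :
  is_subgroup H -> lcong H x y -> lcong H y z -> lcong H x z.
Proof.
case=> _ _ HM xy yz; rewrite /lcong.
have -> : x^-1 * z = (x^-1 * y) * (y^-1 * z) by rewrite mulgA mulgK.
exact: HM.
Qed.

Lemma lcong_mul H g x y : lcong H (g * x) (g * y) = lcong H x y.
Proof. by rewrite /lcong invgM -mulgA mulKg. Qed.

(** A path of edges of the Bass-Serre tree inside Y, consecutive ones sharing a vertex; it expresses
    connectedness of the subgraph with edge set Y. *)
Inductive walk A E Y y : G -> Prop :=
| walk_nil : walk A E Y y y
| walk_step x z : walk A E Y y x -> Y x -> Y z ->
    lcong A x z \/ lcong E x z -> walk A E Y y z.

Lemma walk_trans A E Y y x z :
  walk A E Y x y -> walk A E Y y z -> walk A E Y x z.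
Proof. by move=> xy; elim=> // u v _ xu Yu Yv; exact: walk_step. Qed.

Lemma walk_sym A E Y x y : is_subgroup A -> is_subgroup E ->
  walk A E Y x y -> walk A E Y y x.
Proof.
move=> sA sE; elim=> [|u v _ ux Yu Yv uv]; first exact: walk_nil.
apply: (walk_trans _ ux); apply: (walk_step (walk_nil _ _ _ _)) => //.
by case: uv => uv; [left|right]; exact: lcong_sym.
Qed.

Lemma walk_mul A E Y g x y : (forall z, Y z -> Y (g * z)) ->
  walk A E Y x y -> walk A E Y (g * x) (g * y).
Proof.
move=> gY; elim=> [|u v _ ux Yu Yv uv]; first exact: walk_nil.
by apply: (walk_step ux (gY _ Yu) (gY _ Yv)); rewrite !lcong_mul.
Qed.

End Cosets.

(** * An equivariant flow on the tree with merging flow lines *)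

Section Flow.
Local Open Scope group_scope.
Variable G : groupType.
(* Each A-class has a unique good direction; the flow [nx] below leaves it along
   that direction, and leaves an E-class through its non-good A-class, if any.
   Flow lines of Gam-translates merge, so every g in Gam shifts far flow lines
   by a constant. Hence commutators fix a far vertex. *)
Variables (A E Gam Y good : set G).
Hypothesis sA : is_subgroup A.
Hypothesis sE : is_subgroup E.
Hypothesis sGam : is_subgroup Gam.
Hypothesis Y1 : Y 1.
Hypothesis GamY : forall g y, Gam g -> Y y -> Y (g * y).
Hypothesis free : forall g y, Gam g -> lcong A y (g * y) \/ lcong E y (g * y) ->
  g = 1.
Hypothesis Ywalk : forall y, Y y -> walk A E Y 1 y.
Hypothesis good_ex : forall y, Y y -> exists2 x, Y x /\ lcong A y x & good x.
Hypothesis good_uniq : forall x y, Y x -> Y y -> lcong A x y ->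
  good x -> good y -> lcong E x y.
Hypothesis good_mul : forall g y, Gam g -> Y y -> good (g * y) <-> good y.
Hypothesis good_or : forall x y, Y x -> Y y -> lcong E x y -> ~ lcong A x y ->
  good x \/ good y.

Let cl H x : set G := [set y | Y y /\ lcong H x y].
Let act g (S : set G) : set G := [set x | S (g^-1 * x)].
Let state := (bool * set G)%type.
Let sact g (s : state) : state := (s.1, act g s.2).
Let st b x : state := (b, cl (if b then A else E) x).

(** The boolean [true] marks a vertex of type A. An E-vertex all of whose edges are good is a sink,
    where the flow stays. *)
Let nx (s : state) : state :=
  if s.1 then (false, [set y | Y y /\ exists2 x, s.2 x & good x /\ lcong E x y])
  else if pselect (s.2 `<=` good) then s
  else (true, [set y | Y y /\ exists2 x, s.2 x & ~ good x /\ lcong A x y]).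

Let cl_eq H x y : is_subgroup H -> lcong H x y -> cl H x = cl H y.
Proof.
move=> sH xy; apply/seteqP; split=> z [Yz xz]; split=> //.
  by apply: lcong_trans xz => //; exact: lcong_sym.
exact: lcong_trans xy xz.
Qed.

Let st_eq (b : bool) x y : lcong (if b then A else E) x y -> st b x = st b y.
Proof. by move=> xy; congr pair; apply: cl_eq xy; case: b. Qed.

Let nxA x : Y x -> good x -> nx (st true x) = st false x.
Proof.
move=> Yx gx; congr pair; apply/seteqP; split=> y [Yy].
  case=> u [Yu xu] [gu uy]; split=> //.
  by apply: lcong_trans uy => //; exact: good_uniq.
by move=> xy; split=> //; exists x => //; split=> //; exact: lcong_refl.
Qed.

Let nxE x : Y x -> ~ good x -> nx (st false x) = st true x.
Proof.
move=> Yx gx; rewrite /nx /=; case: pselect => [/(_ x) h|_] /=.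
  by case: gx; apply: h; split=> //; exact: lcong_refl.
congr pair; apply/seteqP; split=> y [Yy].
  case=> u [Yu xu] [gu uy]; split=> //.
  apply: lcong_trans uy => //; apply: contrapT => xu'.
  by case: (good_or Yx Yu xu xu').
by move=> xy; split=> //; exists x => //; split=> //; exact: lcong_refl.
Qed.

Let nxEE x : cl E x `<=` good -> nx (st false x) = st false x.
Proof. by rewrite /nx /=; case: pselect. Qed.

Let sact_st g b x : Gam g -> sact g (st b x) = st b (g * x).
Proof.
move=> Gg; have [_ GV _] := sGam; have Gg' := GV _ Gg.
congr pair; apply/seteqP; split=> y [Yy xy]; split.
- by rewrite -(mulVKg g y); exact: GamY.
- by rewrite -(mulVKg g y) lcong_mul.
- exact: GamY.
- by rewrite -(lcong_mul _ g) mulVKg.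
Qed.

Let valid s := exists b, exists2 x, Y x & s = st b x.

Let nx_sact s g : valid s -> valid (nx s) /\
  (Gam g -> nx (sact g s) = sact g (nx s)).
Proof.
case=> -[] [x Yx ->].
  have [y [Yy xy] gy] := good_ex Yx.
  have -> : st true x = st true y by apply: st_eq.
  rewrite nxA //; split; first by exists false, y.
  by move=> Gg; rewrite !sact_st // nxA //; [exact: GamY|exact/good_mul].
have [h|/existsNP[y /not_implyP[[Yy xy] gy]]] := pselect (cl E x `<=` good).
  rewrite nxEE //; split; first by exists false, x.
  move=> Gg; have [_ GV _] := sGam; have Gg' := GV _ Gg.
  rewrite sact_st // nxEE // => y [Yy xy].
  have Yg : Y (g^-1 * y) by exact: GamY.
  rewrite -(mulVKg g y); apply/good_mul => //; apply: h; split=> //.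
  by rewrite -(lcong_mul _ g) mulVKg.
have -> : st false x = st false y by apply: st_eq.
rewrite nxE //; split; first by exists true, y.
move=> Gg; rewrite !sact_st // nxE //; first exact: GamY.
by move=> /good_mul; auto.
Qed.

Let valid_iter k s : valid s -> valid (iter k nx s).
Proof. by move=> vs; elim: k => //= k /(fun h => (nx_sact 1 h).1). Qed.

Let iter_sact k s g : Gam g -> valid s ->
  iter k nx (sact g s) = sact g (iter k nx s).
Proof.
move=> Gg vs; elim: k => //= k ->.
exact: (nx_sact g (valid_iter k vs)).2.
Qed.

Let merge s t := exists k l, iter k nx s = iter l nx t.

Let merge_trans s t u : merge s t -> merge t u -> merge s u.
Proof.
move=> [k [l e]] [k' [l' e']]; exists (k' + k)%N, (l + l')%N.
by rewrite !iterD e -e' -!iterD addnC.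
Qed.

Let merge_sym s t : merge s t -> merge t s.
Proof. by move=> [k [l e]]; exists l, k. Qed.

(** If both edges are good, both A-vertices flow into the common E-vertex; otherwise that E-vertex
    flows on into the vertex of y. *)
Let merge_good x y : Y x -> Y y -> lcong E x y -> good x ->
  merge (st true x) (st true y).
Proof.
move=> Yx Yy xy gx.
have e : st false x = st false y by apply: st_eq.
have [gy|gy] := pselect (good y); first by exists 1%N, 1%N; rewrite /= !nxA.
by exists 2%N, 0%N; rewrite /= nxA // e nxE.
Qed.

Let merge_walk x : walk A E Y 1 x -> merge (st true 1) (st true x).
Proof.
elim=> [|u v _ mu Yu Yv uv]; first by exists 0%N, 0%N.
apply: (merge_trans mu).
have [h|h] := pselect (lcong A u v).
  by exists 0%N, 0%N => /=; exact: st_eq.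
case: uv => // uv; have [gu|gv] := good_or Yu Yv uv h.
  exact: merge_good.
by apply: merge_sym; apply: merge_good => //; exact: lcong_sym.
Qed.

(** The flow lines of the vertices 1A and gA merge because Y is connected, and by equivariance the
    second is the g-translate of the first. *)
Let merge_shift g : Gam g -> exists k l, forall m,
  iter (m + k) nx (st true 1) = sact g (iter (m + l) nx (st true 1)).
Proof.
move=> Gg; have [|k [l e]] := @merge_walk g.
  by apply: Ywalk; rewrite -(mulg1 g); exact: GamY.
have v1 : valid (st true 1) by exists true, 1.
exists k, l => m; by rewrite !iterD e -!iterD -iter_sact // sact_st // mulg1.
Qed.

Lemma flow_commute a b : Gam a -> Gam b -> a * b = b * a.
Proof.
have [_ GV GM] := sGam.
move=> Ga Gb; have [k [l ea]] := merge_shift Ga.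
have [k' [l' eb]] := merge_shift Gb.
have [|c [x Yx ex]] := @valid_iter (l + l')%N (st true 1).
  by exists true, 1.
(* Both sides equal [iter (k + k') nx (st true 1)]: a trades l for k and b trades l' for k', in
   either order. *)
have e : sact a (sact b (st c x)) = sact b (sact a (st c x)).
  rewrite -ex -[in LHS]eb [in LHS](addnC l) -[in LHS]ea.
  by rewrite [in RHS](addnC l) -[in RHS]ea [in RHS](addnC l') -[in RHS]eb addnC.
move: e; rewrite !sact_st // => -[] e.
have Yab : Y (a * (b * x)) by apply: (GamY Ga); exact: GamY.
have sH : is_subgroup (if c then A else E) by case: (c).
have : cl (if c then A else E) (b * (a * x)) (a * (b * x)).
  by rewrite -e; split=> //; exact: lcong_refl.
case=> _ h; suff : a * b * (b * a)^-1 = 1.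
  by move/eqP; rewrite divg_eq1 => /eqP.
apply: (@free _ (b * (a * x))); first by apply: (GM); [exact: GM|exact/GV/GM].
rewrite invgM !mulgA mulgVK mulgVK -!mulgA.
by case: (c) h => h; [left|right].
Qed.

End Flow.

(** * Paths without backtracking in a locally finite subgraph *)

Section ReducedPaths.
Local Open Scope group_scope.
Variable G : groupType.
Variables A E Y : set G.
Hypothesis sA : is_subgroup A.
Hypothesis sE : is_subgroup E.

(** E-steps that change the A-vertex alternate with A-steps that change the E-vertex, so the path
    never backtracks; n counts the E-steps. *)
Inductive rpath (x : G) : nat -> G -> Prop :=
| rpath_one y : Y x -> Y y -> lcong E x y -> ~ lcong A x y -> rpath x 1 y
| rpath_step n y z w : rpath x n y -> Y z -> Y w -> lcong A y z ->
    ~ lcong E y z -> lcong E z w -> ~ lcong A z w -> rpath x n.+1 w.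

Lemma rpath_end x n y : rpath x n y -> Y y.
Proof. by case. Qed.

Lemma rpath_start x n y : rpath x n y -> Y x.
Proof. by elim. Qed.

(* A further E-step that stays in the last E-coset of a reduced path replaces
   the last step instead of extending the path. *)
Lemma walk_rpath y t : Y y -> walk A E Y y t -> lcong A y t \/
  exists x n z, [/\ lcong A y x, rpath x n z & lcong A z t].
Proof.
move=> Yy; elim=> [|u v _ IH Yu Yv uv]; first by left; exact: lcong_refl.
have [Auv|Auv] := pselect (lcong A u v).
  case: IH => [yu|[x [n [z [yx xz zu]]]]].
    by left; exact: lcong_trans Auv.
  by right; exists x, n, z; split=> //; exact: lcong_trans Auv.
case: uv => // uv; have vv : lcong A v v by exact: lcong_refl.
case: IH => [yu|[x [n [z [yx xz zu]]]]].
  by right; exists u, 1%N, v; split=> //; exact: rpath_one.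
have [Ezu|Ezu] := pselect (lcong E z u); last first.
  right; exists x, n.+1, v; split=> //.
  exact: (rpath_step xz Yu Yv zu).
case: xz zu Ezu => [{}z Yx Yz Exz Axz|{}n w {}z r xw Yz Yr wz Ewz zr Azr] zu Ezu.
  have xv : lcong E x v.
    by apply: (lcong_trans sE Exz); exact: (lcong_trans sE Ezu).
  have [Axv|Axv] := pselect (lcong A x v).
    by left; exact: lcong_trans Axv.
  by right; exists x, 1%N, v; split=> //; exact: rpath_one.
have zv : lcong E z v.
  by apply: (lcong_trans sE zr); exact: (lcong_trans sE Ezu).
have [Azv|Azv] := pselect (lcong A z v).
  by right; exists x, n, w; split=> //; exact: lcong_trans Azv.
right; exists x, n.+1, v; split=> //.
exact: (rpath_step xw Yz Yv wz).
Qed.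

Hypothesis finA : forall y, Y y -> finite_set [set z | Y z /\ lcong A y z].
Hypothesis finE : forall y, Y y -> finite_set [set z | Y z /\ lcong E y z].

Lemma finite_rpath x n : finite_set [set z | rpath x n z].
Proof.
elim: n => [|n IH].
  by rewrite (_ : mkset _ = set0) // -subset0 => y; inversion 1.
pose step y := \bigcup_(z in [set z | Y z /\ lcong A y z])
  [set w | Y w /\ lcong E z w].
have fstep y : Y y -> finite_set (step y).
  by move=> Yy; apply: bigcup_finite => [|z [Yz _]]; [exact: finA|exact: finE].
have [Yx|Yx] := pselect (Y x); last first.
  by rewrite (_ : mkset _ = set0) // -subset0 => y /rpath_start.
apply: (@sub_finite_set _ _ ([set w | Y w /\ lcong E x w] `|`
    \bigcup_(y in [set z | rpath x n z]) step y)).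
  move=> w; inversion 1; subst; first by left.
  by right; exists y => //; exists z.
rewrite finite_setU; split; first exact: finE.
by apply: bigcup_finite => // y /rpath_end; exact: fstep.
Qed.

(** By local finiteness only finitely many elements are reached by reduced paths with fewer than N
    E-steps, so an infinite T contains farther ones. *)
Lemma long_rpath (T : set G) y N : Y y -> T `<=` Y ->
  (forall t, Y t -> walk A E Y y t) -> infinite_set T ->
  exists t x n z, [/\ T t, (N <= n)%N, lcong A y x, rpath x n z & lcong A z t].
Proof.
move=> Yy TY wY infT; apply: contrapT => noP; apply: infT.
pose cA y := [set z | Y z /\ lcong A y z].
apply: (@sub_finite_set _ _ (cA y `|` \bigcup_(x in cA y)
   \bigcup_(n in `I_N) \bigcup_(z in [set z | rpath x n z]) cA z)).
  move=> t Tt; have Yt := TY _ Tt.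
  have [|[x [n [z [yx xz zt]]]]] := walk_rpath Yy (wY _ Yt); first by left.
  right; exists x; first by split=> //; exact: rpath_start xz.
  exists n; last by exists z.
  rewrite /= ltnNge; apply/negP => Nn; apply: noP.
  by exists t, x, n, z.
rewrite finite_setU; split; first exact: finA.
apply: bigcup_finite; first exact: finA.
move=> x _; apply: bigcup_finite; first exact: finite_II.
move=> n _; apply: bigcup_finite; first exact: finite_rpath.
by move=> z /rpath_end; exact: finA.
Qed.

End ReducedPaths.
(** * Affine and elementary automorphisms *)

Section AffineElementary.
Variable R : realType.
Local Notation C := (cplx R).
Implicit Types f g : polyaut R.

Definition affine f := exists a b c d e h : C,
  a * d - b * c != 0 /\
  forall x y, f (x, y) = (a * x + b * y + e, c * x + d * y + h).

Lemma polyautM f g z : (f * g)%g z = f (g z).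
Proof. by []. Qed.

Lemma polyautVK f z w : f w = z -> (f^-1)%g z = w.
Proof. by move=> <-; exact: aut_funK. Qed.

Lemma polyautKV f z : f ((f^-1)%g z) = z.
Proof. exact: aut_invK. Qed.

Lemma polynomial_affine (a b e : C) : exists P : {poly {poly C}},
  forall x y, P.[x, y] = a * x + b * y + e.
Proof.
exists (a%:P%:P * 'X + b%:P%:P * 'Y + e%:P%:P) => x y.
by rewrite !(hornerD, hornerM, hornerX, hornerC).
Qed.

Lemma affine_polyaut (a b c d e h : C) : a * d - b * c != 0 ->
  exists f, forall x y, f (x, y) = (a * x + b * y + e, c * x + d * y + h).
Proof.
set D := _ - _ => D0.
pose F (z : plane R) := (a * z.1 + b * z.2 + e, c * z.1 + d * z.2 + h).
pose F' (z : plane R) := (d / D * z.1 + - b / D * z.2 + (b * h - d * e) / D,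
   - c / D * z.1 + a / D * z.2 + (c * e - a * h) / D).
have pF : polynomial_map F.
  have [P hP] := polynomial_affine a b e; have [Q hQ] := polynomial_affine c d h.
  by exists P, Q => x y; rewrite hP hQ.
have pF' : polynomial_map F'.
  have [P hP] := polynomial_affine (d / D) (- b / D) ((b * h - d * e) / D).
  have [Q hQ] := polynomial_affine (- c / D) (a / D) ((c * e - a * h) / D).
  by exists P, Q => x y; rewrite hP hQ.
have FK : cancel F F'.
  by case=> x y; rewrite /F /F' /=; congr pair; rewrite /D; field.
have F'K : cancel F' F.
  by case=> x y; rewrite /F /F' /=; congr pair; rewrite /D; field.
by exists (PolyAut pF pF' FK F'K).
Qed.

Lemma shear_polyaut (p : {poly C}) :
  exists f, forall x y, f (x, y) = (x + p.[y], y).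
Proof.
have pS (q : {poly C}) : polynomial_map (fun z : plane R => (z.1 + q.[z.2], z.2)).
  by exists ('X + q%:P), 'Y => x y; rewrite !(hornerD, hornerX, hornerC).
have pS' := pS (- p).
by unshelve eexists (PolyAut (pS p) pS' _ _) => //=;
  case=> x y /=; rewrite hornerN ?addrK ?addrNK.
Qed.

Lemma affine_subgroup : is_subgroup affine.
Proof.
split=> [|f [a [b [c [d [e [h [D0 fE]]]]]]]|
    f g [a [b [c [d [e [h [D0 fE]]]]]]] [a' [b' [c' [d' [e' [h' [D0' gE]]]]]]]].
- exists 1, 0, 0, 1, 0, 0; rewrite mul1r mul0r subr0 oner_eq0; split=> // x y.
  by rewrite /=; congr pair; ring.
- move: D0; set D := _ - _ => D0.
  exists (d / D), (- b / D), (- c / D), (a / D),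
    ((b * h - d * e) / D), ((c * e - a * h) / D); split=> [|x y].
    have -> : d / D * (a / D) - - b / D * (- c / D) = D^-1.
      by rewrite /D; field.
    by rewrite invr_eq0.
  by apply: polyautVK; rewrite fE; congr pair; rewrite /D; field.
- exists (a * a' + b * c'), (a * b' + b * d'), (c * a' + d * c'),
    (c * b' + d * d'), (a * e' + b * h' + e), (c * e' + d * h' + h).
  split=> [|x y]; last by rewrite polyautM gE fE; congr pair; ring.
  have -> : (a * a' + b * c') * (c * b' + d * d') -
    (a * b' + b * d') * (c * a' + d * c') = (a * d - b * c) * (a' * d' - b' * c').
    by ring.
  by rewrite mulf_neq0.
Qed.

Lemma elementary_subgroup : is_subgroup (@elementary R).
Proof.
split=> [|f [a [b [d [p [D0 fE]]]]]|
    f g [a [b [d [p [D0 fE]]]]] [a' [b' [d' [p' [D0' gE]]]]]].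
- exists 1, 1, 0, 0; rewrite mul1r oner_eq0; split=> // x y.
  by rewrite /= horner0 !mul1r !addr0.
- have [a0 b0] : a != 0 /\ b != 0 by move: D0; rewrite mulf_eq0 negb_or => /andP.
  exists a^-1, b^-1, (- (d / b)), (- a^-1 *: (p \Po (b^-1 *: 'X - (d / b)%:P))).
  split=> [|x y]; first by rewrite -invfM invr_eq0.
  apply: polyautVK; rewrite fE hornerZ horner_comp hornerD hornerZ hornerX.
  by rewrite hornerN hornerC; congr pair; field.
- exists (a * a'), (b * b'), (b * d' + d), (a *: p' + (p \Po (b' *: 'X + d'%:P))).
  split=> [|x y]; first by rewrite mulrACA mulf_neq0.
  rewrite polyautM gE fE hornerD hornerZ horner_comp hornerD hornerZ hornerX.
  by rewrite hornerC; congr pair; ring.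
Qed.

Lemma affine_not_elementary f : affine f -> ~ elementary f ->
  exists a b c d e h : C, c != 0 /\
  forall x y, f (x, y) = (a * x + b * y + e, c * x + d * y + h).
Proof.
move=> [a [b [c [d [e [h [D0 fE]]]]]]] nf.
exists a, b, c, d, e, h; split=> //; apply/eqP => c0; apply: nf.
exists a, d, h, (b *: 'X + e%:P); split; first by rewrite c0 mulr0 subr0 in D0.
by move=> x y; rewrite fE hornerD hornerZ hornerX hornerC c0 mul0r add0r addrA.
Qed.

Lemma elementary_not_affine f : elementary f -> ~ affine f ->
  exists (a b d : C) (p : {poly C}), (2 < size p)%N /\
  forall x y, f (x, y) = (a * x + p.[y], b * y + d).
Proof.
move=> [a [b [d [p [D0 fE]]]]] nf; exists a, b, d, p; split=> //.
rewrite ltnNge; apply/negP => sp; apply: nf.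
exists a, p`_1, 0, b, p`_0, d; split; first by rewrite mulr0 subr0.
move=> x y; rewrite fE (horner_coef_wide _ sp) !big_ord_recl big_ord0 /=.
by rewrite expr0 expr1; congr pair; ring.
Qed.

(* An eigenvector of the linear part triangularises it. *)
Lemma affine_conj_elementary f : affine f -> exists g, elementary (f ^ g)%g.
Proof.
move=> [a [b [c [d [e [h [D0 fE]]]]]]].
have [c0|c0] := eqVneq c 0.
  exists 1%g; rewrite conjg1; exists a, d, h, (b *: 'X + e%:P).
  split; first by rewrite c0 mulr0 subr0 in D0.
  by move=> x y; rewrite fE hornerD hornerZ hornerX hornerC c0 mul0r add0r addrA.
have [t ht] : exists t : C, t ^+ 2 = (a - d) ^+ 2 + 4 * b * c.
  by exists (sqrtC ((a - d) ^+ 2 + 4 * b * c)); rewrite sqrtCK.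
have [s hs] : exists s : C, c * s ^+ 2 + (d - a) * s = b.
  exists ((a - d + t) / (2 * c)).
  have -> : b = (t ^+ 2 - (a - d) ^+ 2) / (4 * c) by rewrite ht; field.
  by field.
have [|g gE] := @affine_polyaut s 1 1 0 0 0.
  by rewrite mulr0 mul1r sub0r oppr_eq0 oner_eq0.
exists g; exists (c * s + d), (a - c * s), (e - s * h), (c *: 'X + h%:P); split.
  rewrite (_ : _ * _ = a * d - b * c) // -hs; ring.
move=> x y; rewrite /conjg !polyautM gE fE; apply: polyautVK; rewrite gE.
rewrite hornerD hornerZ hornerX hornerC -hs; congr pair; ring.
Qed.

Lemma loxodromic_not_conj f g :
  loxodromic f -> ~ (affine (g^-1 * f * g)%g \/ elementary (g^-1 * f * g)%g).
Proof.
move=> lf []; rewrite -mulgA -/(conjg f g); last exact: lf.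
by move=> /affine_conj_elementary[h]; rewrite -conjgM; exact: lf.
Qed.

End AffineElementary.
(** * Growth at infinity *)

Section Growth.
Variable R : realType.
Local Notation C := (cplx R).
Implicit Types (u v w : C) (kap K M r : R).

(** The norm of [cplx R] takes its values in [cplx R]; this real-valued version makes the estimates
    accessible to real arithmetic. *)
Definition modulus (x : C) : R := ComplexField.Normc.normc x.

Lemma normE (x : C) : `|x| = real_complex R (modulus x) :> C.
Proof. by []. Qed.

Lemma modulus_ge0 u : 0 <= modulus u.
Proof. by case: u => a b; exact: sqrtr_ge0. Qed.

Lemma modulusM u v : modulus (u * v) = modulus u * modulus v.
Proof. exact: ComplexField.Normc.normcM. Qed.

Lemma modulusD u v : modulus (u + v) <= modulus u + modulus v.
Proof. by rewrite -lecR rmorphD /= -!normE; exact: ler_normD. Qed.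

Lemma modulusN u : modulus (- u) = modulus u.
Proof. by apply: complexI; rewrite -!normE normrN. Qed.

Lemma modulus_gt0 u : (0 < modulus u) = (u != 0).
Proof. by rewrite -ltcR -normE normr_gt0. Qed.

Lemma modulus_lowerD u v : modulus u - modulus v <= modulus (u + v).
Proof. by rewrite lerBlDr -(modulusN v) -{1}(addrK v u); exact: modulusD. Qed.

(** Horner induction on p X + c: either p is already coercive, or it is a nonzero constant and p X +
    c is linear. *)
Lemma poly_coercive (p : {poly C}) M : (1 < size p)%N ->
  exists r, forall w, r <= modulus w -> M <= modulus p.[w].
Proof.
elim/poly_ind: p M => [|p c IH] M; first by rewrite size_poly0.
have [sp _|sp sp'] := ltnP 1 (size p).
  have [r hr] := IH 1 sp; exists (Num.max r (M + modulus c)) => w.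
  rewrite ge_max hornerD hornerM hornerX hornerC => /andP[/hr h1 h2].
  apply: le_trans (modulus_lowerD _ _); rewrite modulusM.
  have := modulus_ge0 w; nra.
have [p0|p0] := eqVneq p 0.
  by move: sp'; rewrite p0 mul0r add0r size_polyC; case: eqP.
have [a pa] : exists a, p = a%:P by exists p`_0; exact: size1_polyC.
have a0 : 0 < modulus a by rewrite modulus_gt0 -polyC_eq0 -pa.
exists ((M + modulus c) / modulus a) => w.
rewrite ler_pdivrMr // => h.
rewrite hornerD hornerM hornerX pa !hornerC.
by apply: le_trans (modulus_lowerD _ _); rewrite modulusM; lra.
Qed.

Lemma poly_superlinear (p : {poly C}) M : (2 < size p)%N ->
  exists r, forall w, r <= modulus w -> M * modulus w <= modulus p.[w].
Proof.
elim/poly_ind: p M => [|p c _] M; first by rewrite size_poly0.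
have [p0|p0 sp] := eqVneq p 0.
  by rewrite p0 mul0r add0r size_polyC; case: eqP.
(* The extra 1 in M + 1 leaves a spare |w|, which absorbs the constant c. *)
have [|r hr] := @poly_coercive p (M + 1).
  by move: sp; rewrite size_MXaddC (negPf p0) /= ltnS.
exists (Num.max r (modulus c)) => w.
rewrite ge_max hornerD hornerM hornerX hornerC => /andP[/hr h1 h2].
apply: le_trans (modulus_lowerD _ _); rewrite modulusM.
have := modulus_ge0 w; nra.
Qed.

(** Points near the line at infinity but away from [1:0:0], the indeterminacy point of the nonaffine
    elementary maps. For large K, [hcone] consists of points near [1:0:0], to which those maps
    contract the rest of that line. *)
Definition vcone kap r : set (plane R) :=
  [set z | kap * modulus z.1 <= modulus z.2 /\ r <= modulus z.2].

Definition hcone K r : set (plane R) :=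
  [set z | K * modulus z.2 <= modulus z.1 /\ r <= modulus z.1].

Lemma elementary_vcone (f : polyaut R) kap K : 0 < kap -> 0 < K ->
  elementary f -> ~ affine f ->
  exists r0, forall z r, r0 <= r -> vcone kap r z ->
    hcone K (K * modulus z.2) (f z).
Proof.
move=> kap0 K0 ef naf; have [a [b [d [p [sp fE]]]]] := elementary_not_affine ef naf.
(* The three parts of the slope pay for the term a x, for K times the second coordinate of the
   image, and for the bound K |y| that remains. *)
have [r0 hr0] := poly_superlinear
  (modulus a / kap + K * (modulus b + modulus d) + K) sp.
exists (Num.max r0 1) => -[x y] r; rewrite ge_max => /andP[r0r r1] [/= h1 h2].
have y1 : 1 <= modulus y by exact: le_trans h2.
have := hr0 y (le_trans r0r h2); rewrite fE /hcone /= => h3.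
have h4 : modulus p.[y] - modulus (a * x) <= modulus (a * x + p.[y]).
  by rewrite (addrC (a * x)); exact: modulus_lowerD.
have h5 : modulus (b * y + d) <= (modulus b + modulus d) * modulus y.
  apply: le_trans (modulusD _ _) _; rewrite modulusM.
  by have := modulus_ge0 d; nra.
have h6 : modulus (a * x) <= modulus a / kap * modulus y.
  rewrite modulusM -mulrA ler_wpM2l ?modulus_ge0 //.
  by rewrite ler_pdivlMl.
have := modulus_ge0 b; have := modulus_ge0 d; have := modulus_ge0 y => y0 d0 b0.
have h7 : K * modulus (b * y + d) <= K * ((modulus b + modulus d) * modulus y).
  by rewrite ler_wpM2l // ltW.
have h8 : 0 <= K * ((modulus b + modulus d) * modulus y).
  by rewrite mulr_ge0 ?mulr_ge0 ?addr_ge0 // ltW.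
by split; nra.
Qed.

(** A nonelementary affine map moves [1:0:0] to [a:c:0] with c nonzero, so it sends a small
    neighbourhood of [1:0:0] into a wide enough vertical cone. *)
Lemma affine_hcone (f : polyaut R) : affine f -> ~ elementary f ->
  exists m, 0 < m /\ forall kap K r z, kap <= m -> m^-1 <= K -> m^-1 <= r ->
    hcone K r z -> vcone kap (kap * modulus z.1) (f z).
Proof.
move=> af nef; have [a [b [c [d [e [h [c0 fE]]]]]]] := affine_not_elementary af nef.
have {}c0 : 0 < modulus c by rewrite modulus_gt0.
(* On the cone, s |u| bounds the first coordinate of the image, and t is so large that d w + h is at
   most half of c u. *)
pose s := modulus a + modulus b + modulus e + 1.
pose t := (modulus d + modulus h) * 2 / modulus c + 1.
have := (modulus_ge0 a, modulus_ge0 b, modulus_ge0 e, modulus_ge0 d, modulus_ge0 h).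
move=> [[[[a0 b0] e0] d0] h0].
have s1 : 1 <= s by rewrite /s; lra.
have t1 : 1 <= t by rewrite /t lerDr divr_ge0 ?mulr_ge0 ?addr_ge0 // ltW.
have tE : (modulus d + modulus h) * 2 <= t * modulus c.
  have : (modulus d + modulus h) * 2 / modulus c * modulus c =
    (modulus d + modulus h) * 2 by rewrite divfK ?gt_eqF.
  by rewrite /t => e1; nra.
have m1 : 0 < modulus c / (2 * s) by rewrite divr_gt0 ?mulr_gt0 //; lra.
exists (Num.min t^-1 (modulus c / (2 * s))); split.
  by rewrite lt_min m1 andbT invr_gt0; lra.
move=> kap K r [u w]; rewrite le_min => /andP[_ kapm].
have m0 : 0 < Num.min t^-1 (modulus c / (2 * s)).
  by rewrite lt_min m1 andbT invr_gt0; lra.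
have mt : t <= (Num.min t^-1 (modulus c / (2 * s)))^-1.
  by rewrite -[leLHS]invrK lef_pV2 ?posrE ?invr_gt0 ?ge_min ?lexx //; lra.
move=> /(le_trans mt) tK /(le_trans mt) tr [/= h1 h2].
have u0 := modulus_ge0 u; have w0 := modulus_ge0 w.
have tu : t <= modulus u := le_trans tr h2.
have tw : t * modulus w <= modulus u by apply: le_trans h1; rewrite ler_wpM2r.
have wu : modulus w <= modulus u by nra.
have v2 : modulus c * modulus u <= 2 * modulus (c * u + d * w + h).
  have e1 : modulus (c * u) - modulus (d * w) <= modulus (c * u + d * w).
    exact: modulus_lowerD.
  have e2 : modulus (c * u + d * w) - modulus h <= modulus (c * u + d * w + h).
    exact: modulus_lowerD.
  rewrite !modulusM in e1 e2.
  have e3 : t * (2 * (modulus d * modulus w + modulus h)) <=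
      t * (modulus c * modulus u) by nra.
  have : 2 * (modulus d * modulus w + modulus h) <= modulus c * modulus u.
    by move: e3; rewrite ler_pM2l //; lra.
  by lra.
have v1 : modulus (a * u + b * w + e) <= s * modulus u.
  apply: le_trans (modulusD _ _) _.
  have := modulusD (a * u) (b * w); rewrite !modulusM => e1.
  by rewrite /s; nra.
have kaps : kap * (2 * s) <= modulus c by rewrite -ler_pdivlMr //; lra.
have [kap0|kap0] := lerP kap 0.
  have := modulus_ge0 (a * u + b * w + e).
  have := modulus_ge0 (c * u + d * w + h).
  by rewrite /vcone fE /=; split; nra.
have v1' := ler_wpM2l (ltW kap0) v1.
have v3 := ler_wpM2r u0 kaps.
have v4 : kap * modulus u <= kap * (s * modulus u).
  by rewrite ler_wpM2l ?ler_peMl // ltW.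
by rewrite /vcone fE /=; split; lra.
Qed.

Lemma affine_bounded (f : polyaut R) : affine f ->
  exists2 M, 0 < M & forall z r, 0 <= r -> modulus z.1 <= r -> modulus z.2 <= r ->
    modulus (f z).1 <= M * (r + 1) /\ modulus (f z).2 <= M * (r + 1).
Proof.
move=> [a [b [c [d [e [h [_ fE]]]]]]].
have := (modulus_ge0 a, modulus_ge0 b, modulus_ge0 e,
  modulus_ge0 c, modulus_ge0 d, modulus_ge0 h).
move=> [[[[[a0 b0] e0] c0] d0] h0].
exists (modulus a + modulus b + modulus e + modulus c + modulus d + modulus h + 1).
  by lra.
move=> [u w] r r0 /= ur wr; rewrite fE /=; have := (modulus_ge0 u, modulus_ge0 w).
move=> [u0 w0]; split; apply: le_trans (modulusD _ _) _.
  by have := modulusD (a * u) (b * w); rewrite !modulusM => e1; nra.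
by have := modulusD (c * u) (d * w); rewrite !modulusM => e1; nra.
Qed.

End Growth.
(** * Jacobians of bivariate polynomials *)

Section BivariateJacobian.
Variable F : numFieldType.
Local Notation B := {poly {poly F}}.
Implicit Types (P Q S T : B) (a : F).

Lemma poly_nat_eq0 (A : idomainType) (p : {poly A}) :
  injective (fun n : nat => n%:R : A) -> (forall n : nat, p.[n%:R] = 0) -> p = 0.
Proof.
move=> injn p0; apply: (@roots_geq_poly_eq0 _ _ [seq n%:R | n <- iota 0 (size p)]).
- by apply/allP => _ /mapP[n _ ->]; apply/rootP.
- by rewrite map_inj_uniq ?iota_uniq.
- by rewrite size_map size_iota.
Qed.

Lemma bipoly_eq P Q : (forall x y, P.[x, y] = Q.[x, y]) -> P = Q.
Proof.
move=> PQ; apply/eqP; rewrite -subr_eq0; apply/eqP.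
have injF : injective (fun n : nat => n%:R : F).
  by move=> m n /eqP; rewrite eqr_nat => /eqP.
apply: poly_nat_eq0 => [m n|m].
  by rewrite -!polyC_natr => /polyC_inj/injF.
apply: poly_nat_eq0 => // n; rewrite -polyC_natr hornerD hornerN.
by rewrite hornerD hornerN PQ subrr.
Qed.

(** The outer variable is x and the coefficients are polynomials in y; accordingly [size] measures
    the degree in x only. *)
Definition dX P : B := P^`().
Definition dY P : B := map_poly deriv P.

Lemma coef_dY P i : (dY P)`_i = (P`_i)^`().
Proof. by rewrite coef_map_id0 ?deriv0. Qed.

Lemma dXD P Q : dX (P + Q) = dX P + dX Q.
Proof. exact: derivD. Qed.

Lemma dYD P Q : dY (P + Q) = dY P + dY Q.
Proof. by apply/polyP => i; rewrite coefD !coef_dY coefD derivD. Qed.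

Lemma dXM P Q : dX (P * Q) = dX P * Q + P * dX Q.
Proof. exact: derivM. Qed.

Lemma dYM P Q : dY (P * Q) = dY P * Q + P * dY Q.
Proof.
apply/polyP => i; rewrite coefD coef_dY !coefM (raddf_sum deriv) -big_split /=.
by apply: eq_bigr => j _; rewrite derivM !coef_dY.
Qed.

Lemma dXC a : dX a%:P%:P = 0.
Proof. exact: derivC. Qed.

Lemma dYC a : dY a%:P%:P = 0.
Proof.
by apply/polyP => i; rewrite coef_dY !coefC; case: eqP; rewrite ?derivC ?deriv0.
Qed.

Definition jac P Q : B := dX P * dY Q - dY P * dX Q.

Lemma jacC P Q : jac P Q = - jac Q P.
Proof. by rewrite /jac opprB mulrC (mulrC (dX Q)). Qed.

Lemma jacPP P : jac P P = 0.
Proof. by rewrite /jac mulrC subrr. Qed.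

Lemma jacD P Q S : jac P (Q + S) = jac P Q + jac P S.
Proof. by rewrite /jac dXD dYD; ring. Qed.

Lemma jacM P Q S : jac P (Q * S) = jac P Q * S + Q * jac P S.
Proof. by rewrite /jac dXM dYM; ring. Qed.

Lemma jacPC P a : jac P a%:P%:P = 0.
Proof. by rewrite /jac dXC dYC !mulr0 subrr. Qed.

Lemma jacP0 P : jac P 0 = 0.
Proof. exact: (jacPC P 0). Qed.

Lemma jacXY : jac 'X 'Y = 1.
Proof.
rewrite /jac /dX derivX derivC mulr0 subr0 mul1r.
apply/polyP => i; rewrite coef_dY !coefC.
by case: eqP => //; rewrite ?derivX ?deriv0.
Qed.

Lemma jac_exp P Q k : jac P (Q ^+ k) = (Q ^+ k.-1 * jac P Q) *+ k.
Proof.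
elim: k => [|k IH]; first by rewrite expr0 -[1]/(1%:P%:P) jacPC.
rewrite exprS jacM IH /=; case: k {IH} => [|k].
  by rewrite !mulr0n mulr0 addr0 expr0 mulr1 mul1r.
by rewrite -mulrnAr mulrA -exprS mulrnAr mulrC -mulrS.
Qed.

Lemma jac_sum P I (r : seq I) (S : I -> B) :
  jac P (\sum_(i <- r) S i) = \sum_(i <- r) jac P (S i).
Proof.
elim: r => [|i r IH]; first by rewrite !big_nil jacP0.
by rewrite !big_cons jacD IH.
Qed.

Lemma jac_monomial P Q S c i j : exists U V, forall Z,
  jac Z (c%:P%:P * (P ^+ i * Q ^+ j)) = U * jac Z P + V * jac Z Q.
Proof.
exists (c%:P%:P * (P ^+ i.-1 *+ i * Q ^+ j)),
  (c%:P%:P * (P ^+ i * (Q ^+ j.-1 *+ j))) => Z.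
by rewrite !jacM !jac_exp jacPC -!mulrnAl; ring.
Qed.

Definition subst_xy T P Q : B :=
  \sum_(p : 'I_(size T) * 'I_(sizeY T))
    (T`_(p.1)`_(p.2))%:P%:P * (P ^+ p.1 * Q ^+ p.2).

Lemma subst_xyE T P Q x y : (subst_xy T P Q).[x, y] = T.[P.[x, y], Q.[x, y]].
Proof.
rewrite /subst_xy -(pair_bigA _ (fun (i : 'I_(size T)) (j : 'I_(sizeY T)) =>
   (T`_i`_j)%:P%:P * (P ^+ i * Q ^+ j))) /=.
rewrite [T.[_]]horner_coef !horner_sum; apply: eq_bigr => i _.
rewrite !horner_sum !hornerM -rmorphXn /= hornerC.
rewrite (horner_coef_wide _ (max_size_coefXY _ _)) mulr_suml.
apply: eq_bigr => j _; rewrite !(hornerM, hornerC, horner_exp); ring.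
Qed.

(** The chain rule: U and V play the partial derivatives of T at (P, Q), and the same pair serves
    every Z. *)
Lemma jac_expand T P Q : exists U V, forall Z,
  jac Z (subst_xy T P Q) = U * jac Z P + V * jac Z Q.
Proof.
rewrite /subst_xy; elim: (index_enum _) => [|p r [U [V IH]]].
  by exists 0, 0 => Z; rewrite big_nil jacP0 !mul0r addr0.
have [U' [V' e]] := jac_monomial P Q 0 (T`_(p.1)`_(p.2)) p.1 p.2.
by exists (U' + U), (V' + V) => Z; rewrite big_cons jacD e IH; ring.
Qed.

Lemma jac_expand2 T T' P Q :
  exists U, jac (subst_xy T P Q) (subst_xy T' P Q) = U * jac P Q.
Proof.
have [U [V e]] := jac_expand T P Q; have [U' [V' e']] := jac_expand T' P Q.
exists (U * V' - V * U').
rewrite e' (jacC _ P) (jacC _ Q) !e !jacPP (jacC Q P); ring.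
Qed.

(** As ['X] and ['Y] are polynomials in P and Q, the chain rule makes [jac P Q] a divisor of
    [jac 'X 'Y], which is 1; units are nonzero constants. *)
Lemma jac_constant T T' P Q : subst_xy T P Q = 'X -> subst_xy T' P Q = 'Y ->
  exists2 J : F, J != 0 & jac P Q = J%:P%:P.
Proof.
move=> eX eY; have [U] := jac_expand2 T T' P Q; rewrite eX eY jacXY => e1.
have : jac P Q \is a GRing.unit by apply/unitrPr; exists U; rewrite mulrC.
rewrite poly_unitE => /andP[s1 u1].
have {}s1 := size1_polyC (eq_leq (eqP s1)).
move: u1; rewrite s1 coefC eqxx poly_unitE => /andP[/eqP s2 u2].
have {}s2 := size1_polyC (eq_leq s2).
exists ((jac P Q)`_0`_0); last by rewrite -s2 -s1.
by move: u2; rewrite unitfE.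
Qed.

Lemma coefM_top (A : nzRingType) (p q : {poly A}) m n :
  (size p <= m.+1)%N -> (size q <= n.+1)%N -> (p * q)`_(m + n) = p`_m * q`_n.
Proof.
move=> sp sq; rewrite coefM.
have mn : (m < (m + n).+1)%N by rewrite ltnS leq_addr.
rewrite (bigD1 (Ordinal mn)) //= addKn big1 ?addr0 // => i im.
have [lim|lmi|eim] := ltngtP i m; last by case/eqP: im; apply: val_inj.
  rewrite [q`_ _]nth_default ?mulr0 //; apply: leq_trans sq _; lia.
by rewrite [p`_ _]nth_default ?mul0r // (leq_trans sp).
Qed.

Lemma coefXderiv (A : nzRingType) (p : {poly A}) i :
  ('X * p^`())`_i = p`_i *+ i.
Proof. by rewrite coefXM coef_deriv; case: i. Qed.

Lemma size_Xderiv (A : nzRingType) (p : {poly A}) n :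
  (size p <= n)%N -> (size ('X * p^`())%R <= n)%N.
Proof.
move=> sp; apply/leq_sizeP => j nj; rewrite coefXderiv nth_default ?mul0rn //.
exact: leq_trans nj.
Qed.

Lemma size_dY P n : (size P <= n)%N -> (size (dY P) <= n)%N.
Proof. by move=> sP; apply: leq_trans (size_poly _ _) sP. Qed.

(** The relation says that (q / p)' = 0. Its top coefficient forces equal degrees; subtracting the
    multiple of p that cancels the leading term of q leaves a solution of lower degree, hence 0. *)
Lemma proportional_of_deriv (p q : {poly F}) : p != 0 ->
  p^`() * q = p * q^`() -> exists c, q = c *: p.
Proof.
move=> p0 pq.
have deg (r : {poly F}) : r != 0 -> p^`() * r = p * r^`() -> size p = size r.
  move=> r0 pr; have sp := polySpred p0; have sr := polySpred r0.
  have : ('X * p^`()) * r = p * ('X * r^`()) by rewrite -mulrA pr mulrCA.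
  move=> /(congr1 (coefp ((size p).-1 + (size r).-1))); rewrite /= !coefM_top.
  - rewrite !coefXderiv -!lead_coefE mulrnAl mulrnAr => /eqP.
    rewrite -!(mulr_natr (_ * _)) (inj_eq (mulfI _)) ?mulf_neq0 ?lead_coef_eq0 //.
    by rewrite eqr_nat => /eqP e; rewrite sp sr e.
  - by rewrite -sp.
  - by rewrite size_Xderiv // -sr.
  - by rewrite size_Xderiv // -sp.
  - by rewrite -sr.
have [->|q0] := eqVneq q 0; first by exists 0; rewrite scale0r.
exists (lead_coef q / lead_coef p); apply/eqP; rewrite -subr_eq0.
set r := _ - _; apply/negPn/negP => r0.
have spr : size p = size r.
  by apply: deg r0 _; rewrite /r derivB derivZ mulrBr pq mulrBr -!mul_polyC; ring.
have : r`_(size r).-1 != 0 by rewrite -lead_coefE lead_coef_eq0.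
rewrite -spr coefB coefZ (deg q q0 pq) -[q`_ _]lead_coefE -(deg q q0 pq).
by rewrite -lead_coefE divfK ?lead_coef_eq0 // subrr eqxx.
Qed.

(* The leading coefficient of the constant jac P Q vanishes, which makes the
   logarithmic derivatives of the leading coefficients of P^k and Q equal. *)
Lemma jac_reduce P Q J k : jac P Q = J%:P%:P -> (1 < size P)%N ->
  (size Q).-1 = (k * (size P).-1)%N -> (0 < k)%N ->
  exists c, (size (Q - c%:P%:P * P ^+ k)%R < size Q)%N.
Proof.
move=> eJ sP sQ k0.
have P0 : P != 0 by rewrite -size_poly_gt0; lia.
have sQ1 : (1 < size Q)%N by nia.
have Q0 : Q != 0 by rewrite -size_poly_gt0; lia.
have p0 : lead_coef P != 0 by rewrite lead_coef_eq0.
have e : lead_coef P * (lead_coef Q)^`() *+ (size P).-1 =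
    (lead_coef P)^`() * lead_coef Q *+ (size Q).-1.
  (* The factor ['X] makes x-differentiation preserve degrees, so the top coefficient on the left
     involves leading coefficients only; on the right it vanishes, as the degree is at most 1. *)
  have : ('X * dX P) * dY Q - dY P * ('X * dX Q) = 'X * J%:P%:P.
    by rewrite -eJ /jac; ring.
  move=> /(congr1 (coefp ((size P).-1 + (size Q).-1))).
  have [sP0 sQ0] := (ltnW sP, ltnW sQ1).
  have sJ : (size (J%:P%:P : B) <= (size Q).-1.+1)%N.
    by apply: leq_trans (size_polyC_leq1 _) _.
  have sX : (size ('X : B) <= (size P).-1.+1)%N.
    by rewrite size_polyX ltnS; case: (size P) sP => [|[]].
  rewrite /= coefB !coefM_top ?size_Xderiv ?size_dY // ?prednK //.
  rewrite !coefXderiv !coef_dY -!lead_coefE mulrnAl mulrnAr => /eqP.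
  have Q1 : ((size Q).-1 == 0%N) = false by apply/negbTE; lia.
  rewrite coefC Q1 mulr0.
  by rewrite subr_eq0 => /eqP.
have [c hc] : exists c, lead_coef Q = c *: (lead_coef P ^+ k).
  apply: proportional_of_deriv; first by rewrite expf_neq0.
  have e' : lead_coef P * (lead_coef Q)^`() = (lead_coef P)^`() * lead_coef Q *+ k.
    set a := LHS; set b := _ * lead_coef Q.
    have : (a - b *+ k) *+ (size P).-1 = 0 by rewrite mulrnBl -mulrnA -sQ e subrr.
    rewrite -mulr_natr -polyC_natr => /eqP.
    rewrite mulf_eq0 polyC_eq0 pnatr_eq0 subr_eq0.
    by rewrite -subn1 subn_eq0 leqNgt sP orbF => /eqP.
  rewrite deriv_exp -[in RHS](prednK k0) exprSr -[RHS]mulrA e'.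
  by rewrite mulrnAr mulrnAl; congr (_ *+ _); ring.
exists c.
have c0 : c != 0.
  apply/eqP => c0; move: hc; rewrite c0 scale0r => /eqP.
  by rewrite lead_coef_eq0 (negPf Q0).
have lk : lead_coef (c%:P%:P * P ^+ k) = lead_coef Q.
  by rewrite lead_coefM lead_coefC lead_coef_exp mul_polyC hc.
have sPk : size (c%:P%:P * P ^+ k)%R = size Q.
  rewrite mul_polyC size_scale ?polyC_eq0 //.
  have e1 : (size (P ^+ k)).-1 = (size Q).-1 by rewrite size_exp sQ mulnC.
  have sPk0 : (0 < size (P ^+ k)%R)%N by rewrite size_poly_gt0 expf_neq0.
  by rewrite -(prednK sPk0) e1 prednK // ltnW.
rewrite ltn_neqAle; apply/andP; split; last first.
  by apply: leq_trans (size_polyD _ _) _; rewrite size_polyN sPk maxnn.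
apply/eqP => e1; have : Q - c%:P%:P * P ^+ k != 0.
  by rewrite -size_poly_gt0 e1 ltnW.
rewrite -lead_coef_eq0 lead_coefE e1 coefB -lead_coefE -sPk -lead_coefE.
by rewrite lk subrr eqxx.
Qed.

Definition combination (a b : nat) (c : 'I_a * 'I_b -> F) P Q : B :=
  \sum_p (c p)%:P%:P * (P ^+ p.1 * Q ^+ p.2).

Definition weight P Q (a b : nat) (p : 'I_a * 'I_b) : nat :=
  ((size P).-1 * p.1 + (size Q).-1 * p.2)%N.

Lemma size_monomial P Q i j : P != 0 -> Q != 0 ->
  size (P ^+ i * Q ^+ j) = ((size P).-1 * i + (size Q).-1 * j).+1.
Proof.
move=> P0 Q0; have Pi : P ^+ i != 0 by rewrite expf_neq0.
have Qj : Q ^+ j != 0 by rewrite expf_neq0.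
by rewrite size_mul // (polySpred Pi) (polySpred Qj) !size_exp addSn addnS.
Qed.

(** [weight] is the degree in x of a term, and a term of strictly largest degree cannot be
    cancelled. *)
Lemma size_combination (a b : nat) (c : 'I_a * 'I_b -> F) P Q p0 :
  P != 0 -> Q != 0 -> c p0 != 0 ->
  (forall p, p != p0 -> c p != 0 -> (weight P Q p < weight P Q p0)%N) ->
  (weight P Q p0 < size (combination c P Q))%N.
Proof.
move=> P0 Q0 c0 hp; rewrite ltnNge; apply/negP => /leq_sizeP/(_ _ (leqnn _)).
rewrite /combination coef_sum (bigD1 p0) //= big1 ?addr0 => [|p pp0].
  have e := size_monomial p0.1 p0.2 P0 Q0.
  rewrite mul_polyC coefZ => /eqP; rewrite mulf_eq0 polyC_eq0.
  rewrite (negPf c0) /= -[X in _`_X]/((weight P Q p0).+1.-1) -e -lead_coefE.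
  by rewrite lead_coef_eq0 -size_poly_eq0 e.
have [->|cp] := eqVneq (c p) 0; first by rewrite mul0r coef0.
rewrite mul_polyC coefZ nth_default ?mulr0 // size_monomial //.
exact: hp.
Qed.

(** * Euler operators and divisibility of the degrees in x *)

Section Euler.
Variables (P Q : B) (J : F).
Hypothesis J0 : J != 0.
Hypothesis eJ : jac P Q = J%:P%:P.

(* [jac P] kills P and sends Q to J, so [euler l] scales P^i Q^j by j - l. *)
Definition euler (l : nat) S : B :=
  Q * ((J^-1)%:P%:P * jac P S) - l%:R * S.

Lemma euler_combination (a b : nat) (c : 'I_a * 'I_b -> F) l :
  euler l (combination c P Q) =
  combination (fun p => (p.2%:R - l%:R) * c p) P Q.
Proof.
rewrite /euler /combination jac_sum !mulr_sumr -sumrB; apply: eq_bigr => p _.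
rewrite !jacM jacPC !jac_exp jacPP mulr0 mul0rn mul0r !mul0r !add0r eJ.
have JV : (J^-1)%:P%:P * J%:P%:P = 1 :> B by rewrite -!polyCM mulVf.
have hj : Q * (Q ^+ p.2.-1 *+ p.2) = p.2%:R * Q ^+ p.2.
  case: (nat_of_ord p.2) => [|j]; rewrite ?mulr0n ?mulr0 ?mul0r //.
  by rewrite mulrnAr -exprS mulr_natl.
rewrite !polyCM !polyCB !polyC_natr.
transitivity ((J^-1)%:P%:P * J%:P%:P * ((c p)%:P%:P * P ^+ p.1) *
  (Q * (Q ^+ p.2.-1 *+ p.2)) - l%:R * ((c p)%:P%:P * (P ^+ p.1 * Q ^+ p.2))).
  by rewrite -!(mulr_natr (_ * _)) -(mulr_natr (Q ^+ _)); ring.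
by rewrite JV hj; ring.
Qed.

(** Each product in [jac P S] contains one x-derivative, which saves a degree; multiplying by Q then
    adds the degree of Q. *)
Lemma size_euler l S : (1 < size P)%N -> (1 < size Q)%N ->
  (size (euler l S) <= size S + ((size P).-1 + (size Q).-1 - 1))%N.
Proof.
move=> sP sQ.
have [->|S0] := eqVneq S 0.
  by rewrite /euler jacP0 !mulr0 subr0 size_poly0.
have sS := polySpred S0.
have sX (U : B) : (size (dX U) <= (size U).-1)%N.
  have [->|U0] := eqVneq U 0; first by rewrite /dX deriv0 size_poly0.
  by have := lt_size_deriv U0; rewrite (polySpred U0) ltnS.
have sY (U : B) : (size (dY U) <= size U)%N by exact: size_dY.
have sM : forall (U V : B) u v w, (size U <= u)%N -> (size V <= v)%N ->
    ((u + v).-1 <= w)%N -> (size (U * V)%R <= w)%N.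
  move=> U V u v w sU sV uvw; apply: leq_trans (size_polyMleq _ _) _.
  by apply: leq_trans uvw; rewrite -!subn1 leq_sub2r // leq_add.
pose n := (size P).-1; pose m := (size Q).-1; pose s := (size S).-1.
have [eP eQ eS] : [/\ size P = n.+1, size Q = m.+1 & size S = s.+1].
  by split=> //; rewrite prednK // ltnW.
have n0 : (0 < n)%N by rewrite -ltnS -eP.
have m0 : (0 < m)%N by rewrite -ltnS -eQ.
have sl : (size (l%:R : B) <= 1)%N by rewrite -polyC_natr size_polyC_leq1.
have sjac : (size (jac P S) <= n + s)%N.
  rewrite /jac; apply: leq_trans (size_polyD _ _) _; rewrite size_polyN geq_max.
  apply/andP; split.
    by apply: (sM _ _ n s.+1); rewrite -?eS ?sX ?sY //; lia.
  by apply: (sM _ _ n.+1 s); rewrite -?eP ?sX ?sY //; lia.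
rewrite /euler -/n -/m eS.
apply: leq_trans (size_polyD _ _) _; rewrite size_polyN geq_max; apply/andP; split.
  apply: (sM _ _ m.+1 (n + s)%N); rewrite ?eQ //; last by lia.
  by apply: (sM _ _ 1%N (n + s)%N) => //; rewrite size_polyC_leq1.
by apply: (sM _ _ 1%N s.+1) => //; rewrite ?eS //; lia.
Qed.

Lemma eulers (a b : nat) (c : 'I_a * 'I_b -> F) (ls : seq nat) :
  (1 < size P)%N -> (1 < size Q)%N ->
  (size (combination (fun p => \prod_(l <- ls) (p.2%:R - l%:R) * c p)%R P Q) <=
  size (combination c P Q) + size ls * ((size P).-1 + (size Q).-1 - 1))%N.
Proof.
move=> sP sQ; elim: ls => [|l ls IH] /=.
  rewrite mul0n addn0 /combination (eq_leq _) //; congr (size (polyseq _)).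
  by apply: eq_bigr => p _; rewrite big_nil mul1r.
have -> : combination (fun p => \prod_(i <- l :: ls) (p.2%:R - i%:R) * c p) P Q =
    euler l (combination (fun p => \prod_(i <- ls) (p.2%:R - i%:R) * c p) P Q).
  rewrite euler_combination; apply: eq_bigr => p _.
  by rewrite big_cons mulrA.
apply: leq_trans (size_euler _ _ _ _) _ => //.
by rewrite mulSn addnCA addnC leq_add2l.
Qed.

(* Among the terms of largest weight W, all but one are killed by Euler operators,
   each raising the degree by at most n + m - 1; starting from the degree 0 of
   'Y this gives W <= (t - 1) (n + m - 1) for t such terms. As these terms have
   equal weight, (t - 1) lcm(n, m) <= W, so lcm(n, m) < n + m. *)
Lemma dvdn_of_combination (a b : nat) (c : 'I_a * 'I_b -> F) :
  (1 < size P)%N -> (1 < size Q)%N -> combination c P Q = 'Y ->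
  (((size P).-1 %| (size Q).-1) || ((size Q).-1 %| (size P).-1))%N.
Proof.
move=> sP sQ eY; pose n := (size P).-1; pose m := (size Q).-1.
have n0 : (0 < n)%N by rewrite /n -ltnS prednK // ltnW.
have m0 : (0 < m)%N by rewrite /m -ltnS prednK // ltnW.
pose supp := [set p | c p != 0]%SET.
have [p1 p1s] : exists p, p \in supp.
  apply/set0Pn/negP => /eqP s0; move: eY.
  rewrite /combination big1 => [/esym/eqP|p _].
    by rewrite polyC_eq0 polyX_eq0.
  have : p \notin supp by rewrite s0 inE.
  by rewrite inE negbK => /eqP ->; rewrite mul0r.
pose wt := @weight P Q a b.
pose p0 := [arg max_(p > p1 in supp) wt p]%N.
have [p0s p0max] : p0 \in supp /\ forall p, p \in supp -> (wt p <= wt p0)%N.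
  by rewrite /p0; case: arg_maxnP.
pose W := wt p0.
pose top := [set p in supp | wt p == W]%SET.
have p0t : p0 \in top by rewrite inE p0s eqxx.
have snd_inj p q : p \in top -> q \in top -> p.2 = q.2 :> nat -> p = q.
  rewrite !inE => /andP[_ /eqP hp] /andP[_ /eqP hq] e2.
  have : (n * p.1 = n * q.1)%N by move: hp; rewrite -hq /wt /weight e2 => /addIn.
  move=> /eqP; rewrite eqn_pmul2l // => /eqP e1.
  by case: p q {hp hq} e1 e2 => [i j] [i' j'] /= /val_inj -> /val_inj ->.
have upper : (W <= #|top|.-1 * (n + m - 1))%N.
  (* These operators kill every top term other than [p0]; the term [p0] survives because top terms
     have distinct exponents of Q. *)
  pose ls := [seq nat_of_ord p.2 | p : 'I_a * 'I_b <- enum (top :\ p0)].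
  have sls : size ls = #|top|.-1 by rewrite size_map -cardE (cardsD1 p0 top) p0t.
  rewrite -sls -ltnS.
  have e1 : (size (combination c P Q) + size ls * ((size P).-1 + (size Q).-1 - 1) =
    (size ls * (n + m - 1)).+1)%N by rewrite eY size_polyC polyX_eq0.
  rewrite -e1; apply: leq_trans (eulers c ls sP sQ).
  have [P0 Q0] : P != 0 /\ Q != 0 by rewrite -!size_poly_gt0 !(ltnW sP, ltnW sQ).
  apply: size_combination => //.
    rewrite mulf_neq0 //; last by rewrite inE in p0s.
    rewrite prodf_seq_neq0; apply/allP => l /mapP[p].
    rewrite mem_enum in_setD1 => /andP[pp0 pt] ->.
    rewrite subr_eq0 eqr_nat; apply: contra pp0 => /eqP e2; apply/eqP.
    exact/esym/snd_inj.
  move=> p pp0; rewrite mulf_eq0 negb_or => /andP[lp cp].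
  have ps : p \in supp by rewrite inE.
  rewrite ltn_neqAle -/wt p0max // andbT; apply: contraNneq lp => wp.
  have pt : p \in top by rewrite inE ps wp eqxx.
  have : (p.2 : nat) \in ls by apply: map_f; rewrite mem_enum in_setD1 pp0 pt.
  by move=> /(big_rem _) ->; rewrite /= subrr mul0r.
have lower : (#|top|.-1 * lcmn n m <= W)%N.
  have L0 : (0 < lcmn n m)%N by rewrite lcmn_gt0 n0 m0.
  (* For top terms the numbers m j agree modulo the lcm, their differences being multiples of n as
     well as of m. The quotients by the lcm are therefore distinct, and none exceeds W / lcm. *)
  pose h (p : 'I_a * 'I_b) := inord (m * p.2 %/ lcmn n m) : 'I_(W %/ lcmn n m).+1.
  have hW p : p \in top -> (m * p.2 %/ lcmn n m < (W %/ lcmn n m).+1)%N.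
    rewrite inE => /andP[_ /eqP <-]; rewrite ltnS leq_div2r //.
    by rewrite /wt /weight leq_addl.
  have hinj : {in top &, injective h}.
    move=> p q pt qt /(congr1 val); rewrite /= !inordK ?hW // => e1.
    apply: snd_inj => //; apply/eqP; rewrite -(eqn_pmul2l m0); apply/eqP.
    have em : m * p.2 = m * q.2 %[mod lcmn n m].
      wlog le_pq : p q pt qt e1 / (m * p.2 <= m * q.2)%N.
        move=> hw; case/orP: (leq_total (m * p.2) (m * q.2)) => /hw.
          by auto.
        by symmetry; auto.
      apply/eqP; rewrite eq_sym eqn_mod_dvd // dvdn_lcm -mulnBr.
      rewrite (dvdn_mulr _ (dvdnn m)) andbT.
      move: pt qt; rewrite !inE /wt /weight -/n -/m.
      move=> /andP[_ /eqP hp] /andP[_ /eqP hq].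
      have -> : (m * (q.2 - p.2) = n * p.1 - n * q.1)%N.
        rewrite mulnBr; move: (etrans hp (esym hq)).
        by move: (n * p.1)%N (m * p.2)%N (n * q.1)%N (m * q.2)%N; lia.
      by rewrite -mulnBr dvdn_mulr.
    by rewrite (divn_eq (m * p.2) (lcmn n m)) e1 em -divn_eq.
  have hc : (#|top| <= (W %/ lcmn n m).+1)%N.
    by rewrite -(card_in_imset hinj) -[X in (_ <= X)%N]card_ord max_card.
  rewrite -leq_divRL // -ltnS; apply: leq_trans hc.
  by rewrite prednK // (cardsD1 p0) p0t.
(* A single top term would have weight 0 and be the only term, making ['Y] a constant. *)
have [t0|t0] := posnP #|top|.-1.
  have W0 : W = 0%N by apply/eqP; rewrite -leqn0 (leq_trans upper) // t0.
  move: eY; rewrite /combination (bigD1 p0) //= big1 => [|p pp0]; last first.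
    have [ps|] := boolP (p \in supp); last first.
      by rewrite inE negbK => /eqP ->; rewrite mul0r.
    have pt : p \in top by rewrite inE ps W0 -leqn0 -W0; exact: p0max.
    have : (0 < #|top|.-1)%N.
      by rewrite (cardsD1 p0 top) p0t (cardsD1 p) in_setD1 pp0 pt.
    by rewrite t0.
  move/eqP: W0; rewrite /W /wt /weight addn_eq0 !muln_eq0 -/n -/m.
  rewrite (gtn_eqF n0) (gtn_eqF m0) /= => /andP[/eqP -> /eqP ->].
  rewrite !expr0 !mulr1 addr0 => /polyC_inj /(congr1 (size \o polyseq)) /=.
  by rewrite size_polyX size_polyC; case: eqP.
have {upper lower} : (lcmn n m <= n + m - 1)%N.
  by rewrite -(leq_pmul2l t0) (leq_trans lower).
(* A multiple of v other than 0 and v is at least 2 v, which exceeds u + v - 1 when u <= v. *)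
have key u v : (0 < u)%N -> (0 < v)%N -> (u <= v)%N -> (lcmn u v <= u + v - 1)%N ->
    (u %| v)%N.
  move=> u0 v0 uv hl; suff <- : lcmn u v = v by exact: dvdn_lcml.
  have /dvdnP[k hk] := dvdn_lcmr u v.
  have : (0 < lcmn u v)%N by rewrite lcmn_gt0 u0 v0.
  move: hl; rewrite hk; case: k {hk} => [|[|k]]; rewrite ?mul1n //; nia.
move=> hl; case/orP: (leq_total n m) => le; apply/orP; [left|right].
  exact: key.
by apply: key => //; rewrite lcmnC addnC.
Qed.

End Euler.

End BivariateJacobian.
(** * Jung's theorem *)

Section Jung.
Variable R : realType.
Local Notation C := (cplx R).
Local Notation B := {poly {poly C}}.
Implicit Types (f g : polyaut R) (P Q : B).

Lemma deriv_eq0 (A : idomainType) (p : {poly A}) :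
  (forall n : nat, n.+1%:R != 0 :> A) -> p^`() = 0 -> exists c, p = c%:P.
Proof.
move=> hA dp; exists p`_0; apply/polyP => -[|i]; first by rewrite coefC eqxx.
have /eqP := congr1 (coefp i) dp; rewrite /= coef_deriv coef0 -mulr_natr.
by rewrite mulf_eq0 (negPf (hA i)) orbF coefC => /eqP.
Qed.

Lemma natr_cplx_neq0 (n : nat) : n.+1%:R != 0 :> C.
Proof. by rewrite pnatr_eq0. Qed.

Lemma natr_poly_neq0 (n : nat) : n.+1%:R != 0 :> {poly C}.
Proof. by rewrite -polyC_natr polyC_eq0 pnatr_eq0. Qed.

Definition components f P Q := forall x y, f (x, y) = (P.[x, y], Q.[x, y]).

Lemma components_expand f P Q : components f P Q ->
  exists S T : B, subst_xy S P Q = 'X /\ subst_xy T P Q = 'Y.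
Proof.
move=> fPQ; have [S [T fST]] := aut_invP f; exists S, T.
have e x y : (subst_xy S P Q).[x, y] = x /\ (subst_xy T P Q).[x, y] = y.
  have := aut_funK f (x, y); rewrite fPQ fST => -[eS eT].
  by rewrite !subst_xyE eS eT.
by split; apply: bipoly_eq => x y;
  rewrite ?((e x y).1, (e x y).2) !(hornerX, hornerC).
Qed.

(** Here Q is a polynomial q(y), so the Jacobian is the product of dP/dx and q'(y). A constant
    nonzero product forces both factors to be constants. *)
Lemma elementary_components f P Q (J : C) : components f P Q -> J != 0 ->
  jac P Q = J%:P%:P -> (size Q <= 1)%N -> elementary f.
Proof.
move=> fPQ J0 eJ /size1_polyC; set q := Q`_0 => eQ.
have dq : dX P * q^`()%:P = J%:P%:P.
  rewrite -eJ /jac eQ /dX derivC mulr0 subr0; congr (_ * _).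
  by apply/polyP => i; rewrite coef_dY !coefC; case: eqP; rewrite ?deriv0.
have dP0 : dX P != 0.
  by apply: contra_eq_neq dq => ->; rewrite mul0r eq_sym !polyC_eq0.
have q0 : q^`() != 0.
  by apply: contra_eq_neq dq => ->; rewrite mulr0 eq_sym !polyC_eq0.
have [r er] : exists r, dX P = r%:P.
  exists (dX P)`_0; apply: size1_polyC.
  have := congr1 (size \o polyseq) dq.
  rewrite /= mulrC mul_polyC size_scale // => ->.
  exact: size_polyC_leq1.
have rq : r * q^`() = J%:P.
  by apply: (@polyC_inj _); rewrite polyCM -er.
have r0 : r != 0 by rewrite -polyC_eq0 -er.
have [sr sq] : (size r <= 1)%N /\ (size q^`() <= 1)%N.
  have := congr1 (size \o polyseq) rq; rewrite /= size_mul // size_polyC J0.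
  have : (0 < size r)%N by rewrite size_poly_gt0.
  have : (0 < size q^`())%N by rewrite size_poly_gt0.
  by move: (size r) (size q^`()) => u v /=; lia.
have /size1_polyC := sr; set al := r`_0 => eal.
have /size1_polyC := sq; set be := q^`()`_0 => ebe.
have [d hd] : exists d : C, q - be *: 'X = d%:P.
  apply: deriv_eq0 natr_cplx_neq0 _.
  by rewrite derivB derivZ derivX ebe alg_polyC subrr.
have [p hp] : exists p : {poly C}, P - r%:P * 'X = p%:P.
  apply: deriv_eq0 natr_poly_neq0 _.
  by rewrite derivB derivM derivC derivX mul0r add0r mulr1 -/(dX P) er subrr.
exists al, be, d, p; split.
  have : (al * be)%:P != 0 by rewrite polyCM -eal -ebe rq polyC_eq0.
  by rewrite polyC_eq0.
move=> x y; rewrite fPQ eQ hornerC -(subrK (be *: 'X) q) hd.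
rewrite -(subrK (r%:P * 'X) P) hp eal.
rewrite !(hornerD, hornerZ, hornerX, hornerC, hornerM).
by congr pair; ring.
Qed.

Lemma walk_subgroup (G : groupType) (A E : set G) :
  is_subgroup A -> is_subgroup E -> is_subgroup [set g | walk A E setT 1%g g].
Proof.
move=> sA sE; split=> /= [|x wx|x y wx wy]; first exact: walk_nil.
  apply: walk_sym => //; have := @walk_mul _ A E setT x^-1 _ _ (fun _ => id) wx.
  by rewrite mulg1 mulVg.
apply: walk_trans wx _; have := @walk_mul _ A E setT x _ _ (fun _ => id) wy.
by rewrite mulg1.
Qed.

(* Jung's theorem, with a decomposition into factors read as a walk from 1 along
   its prefixes. *)
Theorem polyaut_walk f : walk (@affine R) (@elementary R) setT 1%g f.
Proof.
have sA := affine_subgroup R; have sE := elementary_subgroup R.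
have [H1 HV HM] := walk_subgroup sA sE.
set H := mkset _ in H1 HV HM; rewrite -/(H f).
have HA g : affine g -> H g.
  move=> ag; apply: (walk_step (walk_nil _ (@elementary R) setT 1%g)) => //.
  left.
  by rewrite /lcong invg1 mul1g.
have HE g : elementary g -> H g.
  move=> eg; apply: (walk_step (walk_nil (@affine R) _ setT 1%g)) => //.
  right.
  by rewrite /lcong invg1 mul1g.
have HK g h : H g -> H (g * h)%g -> H h.
  by move=> Hg Hgh; rewrite -(mulKg g h); apply: HM => //; exact: HV.
have [s sE'] : exists s : polyaut R, forall x y, s (x, y) = (y, x).
  have D0 : 0 * 0 - 1 * 1 != 0 :> C by rewrite mulr0 mul1r sub0r oppr_eq0 oner_eq0.
  have [s hs] := affine_polyaut 0 0 D0.
  by exists s => x y; rewrite hs !(mul0r, mul1r, add0r, addr0).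
have Hs : H s.
  apply: HA; exists 0, 1, 1, 0, 0, 0.
  split=> [|x y]; first by rewrite mulr0 mul1r sub0r oppr_eq0 oner_eq0.
  by rewrite sE' !(mul0r, mul1r, add0r, addr0).
have Hshear (p : {poly C}) :
    exists2 g : polyaut R, H g & forall x y, g (x, y) = (x + p.[y], y).
  have [g hg] := shear_polyaut p; exists g => //; apply: HE.
  exists 1, 1, 0, p; rewrite mulr1 oner_eq0; split=> // x y.
  by rewrite hg !mul1r addr0.
have [P [Q fPQ]] := aut_funP f.
(* Induction on the sum of the sizes, that is, on the degrees in x; shears will lower it. *)
move: {-1}(size P + size Q)%N (leqnn (size P + size Q)) => N.
elim: N f P Q fPQ => [|N IH] f P Q fPQ sPQ;
  have [S [T [eS eT]]] := components_expand fPQ;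
  have [J J0 eJ] := jac_constant eS eT.
  by apply/HE/(elementary_components fPQ J0 eJ); lia.
have [sQ|sQ] := leqP (size Q) 1; first exact/HE/(elementary_components fPQ J0 eJ).
have J0' : - J != 0 by rewrite oppr_eq0.
have eJ' : jac Q P = (- J)%:P%:P by rewrite jacC eJ !polyCN.
have [sP|sP] := leqP (size P) 1.
  apply: (HK _ _ Hs); apply: HE; apply: (elementary_components _ J0' eJ') => //.
  by move=> x y; rewrite polyautM fPQ sE'.
have lt_sum u v w : (w < v)%N -> (u + v <= N.+1)%N -> (u + w <= N)%N by lia.
have [n0 m0] : (0 < (size P).-1)%N /\ (0 < (size Q).-1)%N.
  by split; rewrite -ltnS prednK // ltnW.
(* By [eT], ['Y] is a combination of monomials in P and Q, with the coefficients of T. *)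
have /orP[/dvdnP[k hk]|/dvdnP[k hk]] := dvdn_of_combination J0 eJ sP sQ eT.
  have k0 : (0 < k)%N by move: m0; rewrite hk muln_gt0 => /andP[].
  have [c hc] := jac_reduce eJ sP hk k0.
  have [t Ht tE] := Hshear (- c *: 'X^k).
  (* Conjugated by the swap, t becomes the shear (x, y) -> (x, y - c x^k). *)
  apply: (HK (s * t * s)%g); first by apply: (HM) => //; exact: HM.
  apply: (IH _ P (Q - c%:P%:P * P ^+ k)); last exact: lt_sum hc sPQ.
  move=> x y; rewrite !polyautM fPQ sE' tE sE' hornerZ hornerXn.
  by rewrite !(hornerD, hornerN, hornerM, hornerC, horner_exp) mulNr.
have k0 : (0 < k)%N by move: n0; rewrite hk muln_gt0 => /andP[].
have [c hc] := jac_reduce eJ' sQ hk k0.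
have [t Ht tE] := Hshear (- c *: 'X^k).
apply: (HK _ _ Ht); apply: (IH _ (P - c%:P%:P * Q ^+ k) Q); last first.
  by rewrite addnC; apply: lt_sum hc _; rewrite addnC.
move=> x y; rewrite !polyautM fPQ tE hornerZ hornerXn.
by rewrite !(hornerD, hornerN, hornerM, hornerC, horner_exp) mulNr.
Qed.

Lemma walk_subset (G : groupType) (A E F F' : set G) x y :
  F `<=` F' -> walk A E F x y -> walk A E F' x y.
Proof.
move=> FF'; elim=> [|u v _ w Fu Fv uv]; first exact: walk_nil.
by apply: (walk_step w _ _ uv); exact: FF'.
Qed.

(** F collects the elements visited by the walk; such sets will provide a finite connected piece of
    the tree. *)
Lemma finite_walk (G : groupType) (A E : set G) x y : walk A E setT x y ->
  exists F : set G, [/\ finite_set F, F x, F y & forall z, F z -> walk A E F x z].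
Proof.
elim=> [|u v _ [F [fF Fx Fu wF]] _ _ uv].
  exists [set x]; split=> // z ->; exact: walk_nil.
have FF : F `<=` F `|` [set v] by exact: subsetUl.
exists (F `|` [set v]); split; [by rewrite finite_setU|exact: FF|by right|].
move=> z [Fz|->]; first exact: walk_subset FF (wF _ Fz).
by apply: (walk_step (walk_subset FF (wF _ Fu)) (FF _ Fu) _ uv); right.
Qed.

End Jung.
(** * Topology of the plane *)

Section PlaneTopology.
Variable R : realType.
Local Notation C := (cplx R).

Lemma modulus_continuous : continuous (@modulus R).
Proof.
move=> x; apply/(@cvgrPdist_lt _ _ _ (nbhs x)) => e e0.
have e0' : 0 < real_complex R e :> C by rewrite (ltcR 0 e).
have near_x := nbhsx_ballx x _ e0'.
apply: filterS near_x => y; rewrite -ball_normE /= normE ltcR => xy.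
have h1 := modulus_lowerD x (- y); have h2 := modulus_lowerD y (- x).
rewrite modulusN -(opprB x y) in h2; rewrite !modulusN in h1 h2.
by rewrite ltr_norml; apply/andP; split; lra.
Qed.

Lemma poly2_continuous (P : {poly {poly C}}) :
  continuous (fun z : plane R => P.[z.1, z.2]).
Proof.
have c1 (c : {poly C}) : continuous (fun z : plane R => c.[z.2]).
  elim/poly_ind: c => [|c a IH] z.
    rewrite (_ : (fun=> _) = cst 0); first exact: cvg_cst.
    by apply/funext => w; rewrite horner0.
  rewrite (_ : (fun=> _) = (fun w : plane R => c.[w.2] * w.2 + a)); last first.
    by apply/funext => w; rewrite hornerMXaddC.
  apply: cvgD; last exact: cvg_cst.
  by apply: cvgM; [exact: IH|exact: cvg_snd].
elim/poly_ind: P => [|P c IH] z.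
  rewrite (_ : (fun=> _) = cst 0); first exact: cvg_cst.
  by apply/funext => w; rewrite !horner0.
rewrite (_ : (fun=> _) = fun w : plane R => P.[w.1, w.2] * w.1 + c.[w.2]);
  last first.
  by apply/funext => w; rewrite !(hornerMXaddC, hornerD, hornerM, hornerC).
apply: cvgD; last exact: c1.
by apply: cvgM; [exact: IH|exact: cvg_fst].
Qed.

Lemma polyaut_continuous (f : polyaut R) : continuous (f : plane R -> plane R).
Proof.
have [P [Q fE]] := aut_funP f => z.
have -> : aut_fun f = (fun w : plane R => (P.[w.1, w.2], Q.[w.1, w.2])).
  by apply/funext => -[x y]; rewrite fE.
by apply: (cvg_pair (F := nbhs z) (G := nbhs P.[z.1, z.2])
  (H := nbhs Q.[z.1, z.2]) (f := fun w : plane R => P.[w.1, w.2])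
  (g := fun w : plane R => Q.[w.1, w.2])); exact: poly2_continuous.
Qed.

Lemma modulus1_continuous : continuous (fun z : plane R => modulus z.1).
Proof.
move=> z; apply: (@continuous_comp _ _ _ fst (@modulus R)); first exact: cvg_fst.
exact: modulus_continuous.
Qed.

Lemma modulus2_continuous : continuous (fun z : plane R => modulus z.2).
Proof.
move=> z; apply: (@continuous_comp _ _ _ snd (@modulus R)); first exact: cvg_snd.
exact: modulus_continuous.
Qed.

Lemma closed_le_continuous (T : topologicalType) (f g : T -> R) :
  continuous f -> continuous g -> closed [set z | f z <= g z].
Proof.
move=> cf cg; have -> : [set z | f z <= g z] = (g \- f) @^-1` [set x | 0 <= x].
  by apply/seteqP; split=> z /=; rewrite subr_ge0.
apply: preimage_closed; last exact: closed_ge.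
by move=> z _; apply: cvgB; [exact: cg|exact: cf].
Qed.

Lemma vcone_closed kap r : closed (@vcone R kap r).
Proof.
apply: closedI; apply: closed_le_continuous => z.
- apply: cvgM; [exact: cvg_cst|exact: modulus1_continuous].
- exact: modulus2_continuous.
- exact: cvg_cst.
- exact: modulus2_continuous.
Qed.

Definition box (r : R) : set (plane R) :=
  [set z | modulus z.1 <= r /\ modulus z.2 <= r].

Lemma box_closed r : closed (box r).
Proof.
apply: closedI; apply: closed_le_continuous => z; try exact: cvg_cst.
- exact: modulus1_continuous.
- exact: modulus2_continuous.
Qed.

(** The disk is closed in the image of the compact square [-r, r]^2 under the continuous map (a, b)
    -> a + i b. *)
Lemma disk_compact r : compact [set u : C | modulus u <= r].
Proof.
pose emb (p : R * R) : C := Complex p.1 p.2.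
have modulus_emb p : modulus (emb p) <= `|p.1| + `|p.2|.
  rewrite /modulus /= -(@ler_pXn2r _ 2) ?nnegrE ?addr_ge0 ?sqrtr_ge0 //.
  rewrite sqr_sqrtr ?addr_ge0 ?sqr_ge0 // sqrrD !real_normK ?num_real //.
  by rewrite lerD2r lerDl mulrn_wge0 // mulr_ge0.
have le_emb p : `|p.1| <= modulus (emb p) /\ `|p.2| <= modulus (emb p).
  by rewrite /modulus /= -!sqrtr_sqr !ler_sqrt ?addr_ge0 ?sqr_ge0 //
    lerDl lerDr !sqr_ge0.
have cemb : continuous emb.
  move=> p; apply/(@cvgrPdist_lt _ _ _ (nbhs p)) => e e0.
  have [er e0r] : exists er : R, e = real_complex R er.
    by exists (complex.Re e); rewrite RRe_real // ger0_real // ltW.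
  subst e; have er0 : 0 < er by rewrite -(ltcR 0 er).
  have er2 : 0 < er / 2 by rewrite divr_gt0.
  apply: filterS (nbhsx_ballx p _ er2) => q [/= h1 h2].
  rewrite normE ltcR.
  have -> : emb p - emb q = emb (p.1 - q.1, p.2 - q.2) by [].
  apply: le_lt_trans (modulus_emb _) _ => /=.
  by move: h1 h2; rewrite -ball_normE /= => h1 h2; lra.
pose sq := `[- r, r]%classic `*` `[- r, r]%classic : set (R * R).
have csq : compact sq by apply: compact_setX; exact: segment_compact.
have cimg : compact (emb @` sq).
  by apply: continuous_compact csq; exact: continuous_subspaceT.
apply: subclosed_compact cimg _.
  apply: (@closed_le_continuous _ (@modulus R) (cst r)).
    exact: modulus_continuous.
  exact: cst_continuous.
move=> [a b] /= ab; exists (a, b) => //.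
have [/= h1 h2] := le_emb (a, b).
by split=> /=; rewrite in_itv /= -ler_norml ?(le_trans h1) ?(le_trans h2).
Qed.

Lemma box_compact r : compact (box r).
Proof. exact: compact_setX (@disk_compact r) (@disk_compact r). Qed.

Lemma preimage_box_compact (f : polyaut R) r : compact ((f^-1)%g @^-1` box r).
Proof.
have -> : (f^-1)%g @^-1` box r = (f : plane R -> plane R) @` box r.
  apply/seteqP; split=> z /=; first by exists ((f^-1)%g z) => //; exact: polyautKV.
  by move=> [w bw <-]; rewrite aut_funK.
apply: continuous_compact (box_compact (r := r)).
by apply: continuous_subspaceT; exact: polyaut_continuous.
Qed.

Lemma closed_polyaut_measurable (f : polyaut R) (A : set (plane R)) :
  closed A -> measurable ((f : plane R -> plane R) @^-1` A : set (borel_plane R)).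
Proof.
move=> cA; rewrite -[X in measurable X]setCK; apply: measurableC.
apply: sub_sigma_algebra; apply: closed_openC.
by apply: preimage_closed cA => z _; exact: polyaut_continuous.
Qed.

End PlaneTopology.

(** * Uniform bounds, maxima and pigeonhole on finite sets *)

Section FiniteSets.
Variable R : realType.

Lemma finite_uniform (T : choiceType) (A : set T) (Q : T -> R -> Prop) :
  finite_set A -> (forall a, A a -> exists r, forall s, r <= s -> Q a s) ->
  exists r, forall a s, A a -> r <= s -> Q a s.
Proof.
move=> /finite_seqP[l ->] {A}; elim: l => [|x l IH] hQ; first by exists 0.
have [|r hr] := IH; first by move=> a al; apply: hQ; rewrite /= inE al orbT.
have [|s hs] := hQ x; first by rewrite /= inE eqxx.
exists (Num.max r s) => a t /=; rewrite inE ge_max => /orP[/eqP ->|al] /andP[rt st].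
  exact: hs.
exact: hr.
Qed.

Lemma finite_maximizer (T : choiceType) (A : set T) (c : T -> R) a0 :
  finite_set A -> A a0 -> exists2 a, A a & forall b, A b -> c b <= c a.
Proof.
move=> /finite_seqP[l ->] {A}; elim: l a0 => [|x l IH] a0 //= _.
have [[y yl]|nl] := pselect (exists y, y \in l); last first.
  exists x; first by rewrite /= inE eqxx.
  by move=> b /=; rewrite inE => /orP[/eqP ->//|bl]; case: nl; exists b.
have [a /= al ha] := IH y yl.
have [cxa|cax] := lerP (c x) (c a).
  exists a; first by rewrite /= inE al orbT.
  by move=> b /=; rewrite inE => /orP[/eqP ->//|/ha].
exists x; first by rewrite /= inE eqxx.
move=> b /=; rewrite inE => /orP[/eqP ->//|/ha] h; exact: le_trans (ltW cax).
Qed.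

(** The elements f^-k g stay in the finite T, so some positive power of f^-1 is 1 and f itself is a
    nonnegative power of f^-1. *)
Lemma finite_set_stable_inv (G : groupType) (T : set G) f :
  finite_set T -> (forall g, T g -> T (f^-1 * g)%g) -> forall g, T g -> T (f * g)%g.
Proof.
move=> fT hT g Tg.
have Tk k : T (f^-1 ^+ k * g)%g.
  by elim: k => [|k IH]; rewrite ?mul1g // expgS -mulgA; exact: hT.
have [i [j [ij e]]] : exists i j, (i < j)%N /\ (f^-1 ^+ i = f^-1 ^+ j)%g.
  apply: contrapT => ninj; apply: infinite_nat.
  have inj : injective (fun k => f^-1 ^+ k * g)%g.
    move=> i j /mulIg e; have [ij|ij|//] := ltngtP i j.
      by case: ninj; exists i, j.
    by case: ninj; exists j, i.
  apply: sub_finite_set (finite_preimage _ fT) => [k _|]; first exact: Tk.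
  by move=> i j _ _; exact: inj.
have {}e : (f^-1 ^+ (j - i) = 1)%g.
  apply: (@mulgI _ (f^-1 ^+ i)%g); rewrite mulg1 -expgnDr subnKC //; exact: ltnW.
have -> : f = (f^-1 ^+ (j - i).-1)%g; last exact: Tk.
have ji : (0 < j - i)%N by rewrite subn_gt0.
apply: (@mulgI _ f^-1%g); rewrite mulVg -expgS prednK //.
Qed.

End FiniteSets.

(** * Stationary measures *)

Section Stationary.
Variables (R : realType) (mu : polyaut R -> R).
Hypothesis mu_fin : finitely_supported_probability mu.
Variable nu : probability (borel_plane R) R.
Hypothesis nu_stat : stationary mu nu.
Implicit Types (f g : polyaut R) (B : set (plane R)).

(** The preimage is the translate of B by g. Stationarity of nu makes this a mu-harmonic function of
    g. *)
Definition mass B g : R := fine (nu ((g^-1)%g @^-1` B)).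

Lemma massE B g : closed B -> nu ((g^-1)%g @^-1` B) = (mass B g)%:E.
Proof.
move=> cB; rewrite /mass fineK // fin_num_measure //.
exact: closed_polyaut_measurable.
Qed.

Lemma mass_ge0 B g : 0 <= mass B g.
Proof. by rewrite fine_ge0. Qed.

Lemma mass_stationary B g : closed B ->
  mass B g = \sum_(f <- fset_set (msupp mu)) mu f * mass B (f^-1 * g)%g.
Proof.
move=> cB; have [_ fS _] := mu_fin.
apply: EFin_inj; rewrite -massE // -(nu_stat (closed_polyaut_measurable _ cB)).
rewrite fsbig_finite // -sumEFin; apply: eq_bigr => f _.
by rewrite EFinM -massE // /pushforward invgM invgK.
Qed.

Lemma mass_eq0 B g f : closed B -> mass B g = 0 -> msupp mu f ->
  mass B (f^-1 * g)%g = 0.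
Proof.
move=> cB; have [mu0 fS _] := mu_fin; rewrite mass_stationary // => /eqP.
rewrite psumr_eq0 => [/allP h Sf|h _]; last by rewrite mulr_ge0 ?mass_ge0.
have := h f; rewrite in_fset_set // mem_set // => /(_ isT).
by rewrite /= mulf_eq0 => /orP[/eqP mf|/eqP//]; move: Sf; rewrite /msupp /= mf eqxx.
Qed.

(** The mu-average of the differences from the maximum is 0 and all of them are nonnegative, so each
    one of positive weight vanishes. *)
Lemma mass_max B g f : closed B ->
  (forall h, msupp mu h -> mass B (h^-1 * g)%g <= mass B g) -> msupp mu f ->
  mass B (f^-1 * g)%g = mass B g.
Proof.
move=> cB hB Sf; have [mu0 fS mu1] := mu_fin.
have : \sum_(h <- fset_set (msupp mu)) mu h * (mass B g - mass B (h^-1 * g)%g) = 0.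
  under eq_bigr do rewrite mulrBr.
  rewrite sumrB -mulr_suml -fsbig_finite // mu1 mul1r.
  by rewrite -mass_stationary // subrr.
move/eqP; rewrite big_seq_cond psumr_eq0 => [/allP h|h]; last first.
  rewrite andbT in_fset_set // => /set_mem Sh.
  by rewrite mulr_ge0 // subr_ge0 hB.
have := h f; rewrite in_fset_set // mem_set // => /(_ isT) /=.
rewrite mulf_eq0 subr_eq0 => /orP[/eqP mf|/eqP//].
by move: Sf; rewrite /msupp /= mf eqxx.
Qed.

Lemma mass_box e : 0 < e -> exists2 r, 0 <= r & 1 - e <= mass (box r) 1%g.
Proof.
move=> e0; pose F n : set (borel_plane R) := box n%:R.
have mF n : measurable (F n).
  exact: (closed_polyaut_measurable 1%g (@box_closed R n%:R)).
have FT : \bigcup_n F n = setT.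
  apply/seteqP; split=> // -[x y] _.
  exists (Num.bound (modulus x + modulus y)) => //; rewrite /F /box /=.
  have := modulus_ge0 x; have := modulus_ge0 y => y0 x0.
  have := archi_boundP (addr_ge0 x0 y0); set N := _%:R => hN.
  by split; lra.
have Fnd : nondecreasing_seq F.
  move=> m n mn; apply/subsetPset => z [/= h1 h2].
  by split; rewrite /= (le_trans (_ : _ <= m%:R)) // ler_nat.
have hcvg : (nu \o F) n @[n --> \oo] --> 1%E.
  rewrite -(probability_setT nu) -FT; apply: nondecreasing_cvg_mu => //.
  by rewrite FT; exact: measurableT.
have [[n hn]|hn] := pselect (exists n, ((1 - e)%:E <= nu (F n))%E).
  by exists n%:R => //; rewrite -lee_fin -massE //; exact: box_closed.
have : (1 <= (1 - e)%:E :> \bar R)%E.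
  rewrite -(cvg_lim _ hcvg) //; apply: lime_le; first by apply/cvg_ex; exists 1%E.
  apply: nearW => n /=; rewrite leNgt; apply/negP => h.
  by apply: hn; exists n; exact: ltW.
by rewrite lee_fin => h; exfalso; lra.
Qed.

(* Maximum principle: a maximum of the mu-harmonic function g |-> nu (g (box r))
   over Gamma would propagate to the whole infinite group. *)
Lemma infinite_mass e : infinite_set (Gamma mu) -> 0 < e ->
  exists2 r, 0 <= r & infinite_set [set g | Gamma mu g /\ 1 - e <= mass (box r) g].
Proof.
move=> infG e0; have [r r0 hr] := mass_box e0; exists r => // fT.
have [G1 GV GM] := generated_is_subgroup (msupp mu).
have SG : msupp mu `<=` Gamma mu by move=> f Sf H [_]; exact.
have SV f : msupp mu f -> generated (msupp mu) f^-1%g.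
  by move=> Sf; apply: GV; exact: SG.
set T := mkset _ in fT.
have [a [Ga ea] ha] := finite_maximizer (mass (box r)) fT (conj G1 hr : T 1%g).
(* Outside T the mass is below 1 - e, so the maximum over the finite T is one over Gamma. *)
have hG g : Gamma mu g -> mass (box r) g <= mass (box r) a.
  move=> Gg; have [h|h] := lerP (1 - e) (mass (box r) g); first by apply: ha.
  by rewrite (le_trans (ltW h)).
pose Tm := [set g | Gamma mu g /\ mass (box r) g = mass (box r) a].
have fTm : finite_set Tm.
  by apply: sub_finite_set fT => g [Gg eg]; split; rewrite ?eg.
have TmV f g : msupp mu f -> Tm g -> Tm (f^-1 * g)%g.
  move=> Sf [Gg eg]; split; first by apply: GM => //; exact: SV.
  rewrite (mass_max (@box_closed R r) _ Sf) // => h Sh; rewrite eg; apply: hG.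
  by apply: GM => //; exact: SV.
(* The stabiliser of the set of maximisers contains the support of mu, hence Gamma; the finite [Tm]
   then contains the whole orbit of a. *)
pose H := [set h | forall g, Tm g <-> Tm (h * g)%g].
have sH : is_subgroup H.
  split=> [g|h Hh g|h k Hh Hk g]; first by rewrite mul1g.
    by rewrite (Hh (h^-1 * g)%g) mulVKg.
  by rewrite (Hk g) (Hh (k * g)%g) mulgA.
have GH : Gamma mu `<=` H.
  apply: generated_min sH _ => f Sf g; split=> [Tg|/(TmV _ _ Sf)].
    by apply: finite_set_stable_inv Tg => // h; exact: TmV.
  by rewrite mulKg.
apply: infG; apply: sub_finite_set (finite_image (fun g => g * a^-1)%g fTm).
move=> g Gg; exists (g * a)%g; last by rewrite mulgK.
by apply: (proj1 (GH g Gg a)); split.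
Qed.

End Stationary.

(** * Finiteness of the transition maps between charts *)

Section OrbitTransitions.
Local Open Scope group_scope.
Variables (G : groupType) (Gam F : set G).
Hypothesis sGam : is_subgroup Gam.
Hypothesis finF : finite_set F.

Definition orbit_set : set G := [set g * p | g in Gam & p in F].

Definition transitions (H : set G) : set G :=
  [set a | H a /\ exists x y, [/\ orbit_set x, orbit_set y & a = x^-1 * y]].

(** Each pair (p, q) contributes at most one map: if p^-1 g q and p^-1 h q lie in H, so does p^-1 h
    g^-1 p, and freeness gives h = g. *)
Lemma finite_transitions H : is_subgroup H ->
  (forall g p, Gam g -> H (p^-1 * g * p) -> g = 1) -> finite_set (transitions H).
Proof.
move=> [_ HV HM] free; have [_ GV GM] := sGam.
apply: (@sub_finite_set _ _ (\bigcup_(p in F) \bigcup_(q in F)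
  [set a | H a /\ exists2 g, Gam g & a = p^-1 * g * q])).
  move=> a [Ha [x [y [[g Gg [p Fp <-]] [h Gh [q Fq <-]] ea]]]].
  exists p => //; exists q => //; split=> //; exists (g^-1 * h).
    by apply: GM => //; exact: GV.
  by rewrite ea invgM !mulgA.
apply: bigcup_finite => // p Fp; apply: bigcup_finite => // q Fq.
have [[a [Ha [g Gg ea]]]|no] := pselect (exists a, H a /\
    exists2 g, Gam g & a = p^-1 * g * q); last first.
  by rewrite (_ : mkset _ = set0) // -subset0 => a ha; apply: no; exists a.
apply: (@sub_finite_set _ _ [set a]) => // b [Hb [h Gh eb]].
have gh : h * g^-1 = 1.
  apply: (free _ p); first by apply: GM => //; exact: GV.
  have -> : p^-1 * (h * g^-1) * p = b * a^-1.
    by rewrite ea eb !invgM invgK !mulgA mulgK.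
  by apply: HM => //; exact: HV.
rewrite /= ea eb; move/eqP: gh; rewrite divg_eq1 => /eqP ->.
by [].
Qed.

Lemma transitions_mem H x y : orbit_set x -> orbit_set y -> lcong H x y ->
  transitions H (x^-1 * y).
Proof. by move=> Yx Yy xy; split=> //; exists x, y. Qed.

Lemma finite_lcong H y : orbit_set y -> finite_set (transitions H) ->
  finite_set [set z | orbit_set z /\ lcong H y z].
Proof.
move=> Yy fT; apply: sub_finite_set (finite_image (fun a => y * a) fT).
by move=> z [Yz yz]; exists (y^-1 * z); [exact: transitions_mem|rewrite mulVKg].
Qed.

End OrbitTransitions.

(** * Consequences of freeness: noncommutation and infinite order *)

Section FreePair.
Local Open Scope group_scope.
Variables (G : groupType) (a b : G).
Hypothesis fab : free_pair a b.

Lemma free_pair_noncommuting : a * b <> b * a.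
Proof.
(* The reduced word is the commutator a b a^-1 b^-1. *)
move=> ab; have := fab (w := [:: (false, false); (true, false);
  (false, true); (true, true)]) isT isT; apply.
rewrite !big_cons big_nil /letter /= mulg1 !mulgA ab.
by rewrite -!mulgA mulVKg mulgV.
Qed.

Lemma free_pair_infinite (H : set G) : is_subgroup H -> H a -> infinite_set H.
Proof.
move=> [H1 HV HM] Ha fH; apply: infinite_nat.
have ak k : (0 < k)%N -> a ^+ k <> 1.
  move=> k0; have := fab (w := nseq k (false, false)).
  have -> : \prod_(l <- nseq k (false, false)) letter a b l = a ^+ k.
    by rewrite big_nseq; elim: k {k0} => //= k ->; rewrite expgS.
  apply; last by case: k k0.
  by rewrite /reduced; case: k {k0} => //= k; elim: k.
have Hk k : H (a ^+ k) by elim: k => [|k IH] //; rewrite expgS; exact: HM.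
apply: sub_finite_set (finite_preimage _ fH) => [k _|]; first exact: Hk.
have inj i j : (i < j)%N -> a ^+ i = a ^+ j -> False.
  move=> ij e; apply: (@ak (j - i)%N); first by rewrite subn_gt0.
  by apply: (@mulgI _ (a ^+ i)); rewrite mulg1 -expgnDr subnKC // ltnW.
by move=> i j _ _ e; have [ij|ij|//] := ltngtP i j; case: (inj _ _ ij _).
Qed.

End FreePair.

(** * Uniform ping-pong constants for finitely many transitions *)

Section PingPong.
Variable R : realType.

(** The affine maps fix s first, and kap = 1/s. Then r is taken large enough for the elementary maps
    to send the cone into [hcone] with slope 2 s; the affine step returns a factor kap * 2 s = 2,
    whence the doubling. *)
Lemma pingpong_constants (TA TE : set (polyaut R)) :
  finite_set TA -> finite_set TE -> TA `<=` @affine R -> TE `<=` @elementary R ->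
  exists kap r C M : R, [/\ 1 <= r,
    forall e a z, TE e -> ~ affine e -> TA a -> ~ elementary a -> vcone kap r z ->
      vcone kap r (a (e z)) /\ 2 * modulus z.2 <= modulus (a (e z)).2,
    forall e z, TE e -> ~ affine e -> vcone kap r z ->
      modulus z.2 <= modulus (e z).1,
    forall a z, TA a -> ~ elementary a -> ~ vcone kap r z ->
      ~ vcone kap r (a z) -> box C z
    & forall a z p, TA a -> 0 <= p -> box p z -> modulus (a z).1 <= M * (p + 1)].
Proof.
move=> fA fE sA sE.
have [s0 hs0] : exists s0, forall a s, TA a -> s0 <= s -> ~ elementary a ->
    forall kap K r z, kap <= s^-1 -> s <= K -> s <= r ->
    hcone K r z -> vcone kap (kap * modulus z.1) (a z).
  apply: (finite_uniform (Q := fun a s => ~ elementary a ->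
    forall kap K r z, kap <= s^-1 -> s <= K -> s <= r ->
    hcone K r z -> vcone kap (kap * modulus z.1) (a z))) => // a Ta.
  have [ea|nea] := pselect (elementary a); first by exists 0.
  have [m [m0 hm]] := affine_hcone (sA _ Ta) nea.
  exists m^-1 => s ms _ kap K r z h1 h2 h3.
  have m'0 : 0 < m^-1 by rewrite invr_gt0.
  apply: hm; [|exact: le_trans h2|exact: le_trans h3].
  apply: le_trans h1 _; rewrite -[leRHS]invrK lef_pV2 ?posrE //.
  exact: lt_le_trans ms.
pose s := Num.max s0 1; have s1 : 1 <= s by rewrite le_max lexx orbT.
have s00 : s0 <= s by rewrite le_max lexx.
have {}hs0 a := fun Ta => hs0 a s Ta s00.
have s_gt0 : 0 < s by exact: lt_le_trans s1.
pose kap := s^-1; have kap0 : 0 < kap by rewrite invr_gt0.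
have kaps : kap * s = 1 by rewrite mulVf ?gt_eqF.
have K0 : 0 < 2 * s by rewrite mulr_gt0.
have [r0 hr0] : exists r0, forall e r, TE e -> r0 <= r -> ~ affine e ->
    forall z, vcone kap r z -> hcone (2 * s) (2 * s * modulus z.2) (e z).
  apply: (finite_uniform (Q := fun e r => ~ affine e ->
    forall z, vcone kap r z ->
      hcone (2 * s) (2 * s * modulus z.2) (e z))) => // e Te.
  have [ae|nae] := pselect (affine e); first by exists 0.
  have [r0 h] := elementary_vcone kap0 K0 (sE _ Te) nae.
  by exists r0 => r rr _ z; exact: h.
pose r := Num.max r0 1; have r1 : 1 <= r by rewrite le_max lexx orbT.
have {}hr0 e := fun Te => hr0 e r Te (_ : r0 <= r).
have [M0 hM0] : exists M0 : R, forall a (M : R), TA a -> M0 <= M ->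
    forall z (p : R), 0 <= p -> box p z -> modulus (a z).1 <= M * (p + 1).
  apply: (finite_uniform (Q := fun (a : polyaut R) (M : R) => forall z (p : R),
    0 <= p -> box p z -> modulus (a z).1 <= M * (p + 1))) => // a Ta.
  have [M M0 hM] := affine_bounded (sA _ Ta); exists M => M' MM' z p p0 [h1 h2].
  have [h _] := hM z p p0 h1 h2; apply: le_trans h _.
  by rewrite ler_wpM2r // addr_ge0.
have rr0 : r0 <= r by rewrite le_max lexx.
have step e z : TE e -> ~ affine e -> vcone kap r z ->
    hcone (2 * s) (2 * s * modulus z.2) (e z).
  by move=> Te nae; apply: hr0.
exists kap, r, (s * r), (Num.max M0 1); split=> //.
- move=> e a z Te nae Ta nea vz; have hz := step _ _ Te nae vz.
  have [k1 k2] := vz; have [k3 k4] := hz.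
  have z1 : 1 <= modulus z.2 by exact: le_trans k2.
  have sz : s <= 2 * s * modulus z.2 by nra.
  have [k5 k6] := hs0 _ Ta nea kap (2 * s) (2 * s * modulus z.2) (e z)
    (lexx _) (ler_peMl (ltW s_gt0) (ler1n R 2)) sz hz.
  have k7 : kap * (2 * s * modulus z.2) <= kap * modulus (e z).1.
    by rewrite ler_wpM2l // ltW.
  have k8 : kap * (2 * s * modulus z.2) = 2 * modulus z.2.
    by rewrite !mulrA (mulrC kap) -(mulrA 2) kaps mulr1.
  have k9 : 2 * modulus z.2 <= modulus (a (e z)).2 by lra.
  by split=> //; split=> //; lra.
- move=> e z Te nae vz; have [k3 k4] := step _ _ Te nae vz.
  by have := modulus_ge0 z.2; nra.
(* Outside the vertical cone, a first coordinate larger than s r dominates the second, and then a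
   sends z into the vertical cone. *)
- move=> a z Ta nea nv nva.
  have z0 := modulus_ge0 z.1; have w0 := modulus_ge0 z.2.
  have kC : kap * (s * r) = r by rewrite mulrA kaps mul1r.
  have [zC|Cz] := lerP (modulus z.1) (s * r).
    split=> //; have [rw|wr] := lerP r (modulus z.2); last by nra.
    have [kz|zk] := lerP (kap * modulus z.1) (modulus z.2); first by case: nv.
    by have : kap * modulus z.1 <= kap * (s * r) by [rewrite ler_wpM2l // ltW]; nra.
  case: nva.
  have kz : kap * (s * r) <= kap * modulus z.1 by rewrite ler_wpM2l // ltW.
  have wk : modulus z.2 <= kap * modulus z.1.
    have [rw|wr] := lerP r (modulus z.2); last by lra.
    by apply: ltW; rewrite ltNge; apply/negP => ?; apply: nv.
  have sw : s * modulus z.2 <= modulus z.1.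
    have : s * modulus z.2 <= s * (kap * modulus z.1) by rewrite ler_wpM2l // ltW.
    by rewrite mulrA (mulrC s kap) kaps mul1r.
  have sz : s <= modulus z.1 by nra.
  have [k5 k6] := hs0 _ Ta nea kap s s z (lexx _) (lexx _) (lexx _) (conj sw sz).
  by split=> //; lra.
- by move=> a z p Ta; apply: hM0 => //; rewrite le_max lexx.
Qed.

End PingPong.
(** * Stationary measures of purely loxodromic walks *)

Section Recurrence.
Variables (R : realType) (mu : polyaut R -> R).
Hypothesis mu_fin : finitely_supported_probability mu.
Hypothesis mu_lox : purely_loxodromic mu.
Variable nu : probability (borel_plane R) R.
Hypothesis nu_stat : stationary mu nu.
Implicit Types (f g x y : polyaut R).

Local Notation A := (@affine R).
Local Notation E := (@elementary R).
Local Notation Gam := (Gamma mu).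
Let sA : is_subgroup A := affine_subgroup R.
Let sE : is_subgroup E := elementary_subgroup R.
Let sGam : is_subgroup Gam := generated_is_subgroup (msupp mu).

Lemma msupp_Gamma f : msupp mu f -> Gam f.
Proof. by move=> Sf H [_]; exact. Qed.

(** Jung's theorem joins 1 to each atom of mu by a finite path; F is the union of these paths. *)
Lemma finite_skeleton : exists F, [/\ finite_set F, F 1%g, msupp mu `<=` F &
  forall p, F p -> walk A E F 1%g p].
Proof.
have [_ /finite_seqP[l ->] _] := mu_fin.
elim: l => [|f l [F [fF F1 lF wF]]].
  by exists [set 1%g]; split=> // p ->; exact: walk_nil.
have [F' [fF' F'1 F'f wF']] := finite_walk (polyaut_walk f).
exists (F `|` F'); split; first by rewrite finite_setU.
- by left.
- by move=> g /=; rewrite inE => /orP[/eqP ->|/lF]; [right|left].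
- by move=> p [/wF|/wF']; apply: walk_subset; [exact: subsetUl|exact: subsetUr].
Qed.

(** Vertex stabilisers are conjugates of A and E and contain no loxodromic element, so Gamma acts
    freely on the vertices. *)
Lemma Gamma_conj_trivial g p : Gam g -> A (p^-1 * g * p)%g \/ E (p^-1 * g * p)%g ->
  g = 1%g.
Proof.
move=> Gg h; apply: contrapT => g1.
exact: (loxodromic_not_conj (mu_lox Gg g1) h).
Qed.

Lemma chart_change x y z : ((y^-1)%g z = (y^-1 * x)%g ((x^-1)%g z)).
Proof. by rewrite polyautM polyautKV. Qed.

Lemma mass_le (B : set (plane R)) g (h : polyaut R) : closed B ->
  (forall z, B ((g^-1)%g z) -> B ((h^-1)%g z)) -> mass nu B g <= mass nu B h.
Proof.
move=> cB gh; rewrite -lee_fin -!massE //.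
by apply: le_measure => //; apply: mem_set; exact: closed_polyaut_measurable.
Qed.

Lemma support_closed : closed (measure_support nu).
Proof.
have -> : measure_support nu =
    \bigcap_(U in [set U | open U /\ ~ (0 < nu U)%E]) ~` U.
  apply/seteqP; split=> z /= hz U; first by move=> [oU nU] Uz; exact/nU/hz.
  by move=> oU Uz; apply: contrapT => nU; exact: (hz U).
by apply: closed_bigI => U [oU _]; exact: open_closedC.
Qed.

(** * The Gamma-invariant subgraph and its good directions *)

Section Orbit.
Variable F : set (polyaut R).
Hypothesis fF : finite_set F.
Hypothesis F1 : F 1%g.
Hypothesis SF : msupp mu `<=` F.
Hypothesis wF : forall p, F p -> walk A E F 1%g p.

Local Notation Y := (orbit_set Gam F).

Lemma orbit_Gamma g : Gam g -> Y g.
Proof. by move=> Gg; exists g => //; exists 1%g => //; rewrite mulg1. Qed.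

Lemma orbit_mul g y : Gam g -> Y y -> Y (g * y)%g.
Proof.
have [_ _ GM] := sGam; move=> Gg [h Gh [p Fp <-]].
by exists (g * h)%g; [exact: GM|exists p => //; rewrite mulgA].
Qed.

Lemma orbit_skeleton : F `<=` Y.
Proof.
have [G1 _ _] := sGam.
by move=> p Fp; exists 1%g => //; exists p => //; rewrite mul1g.
Qed.

(** The elements of Gamma joined to 1 inside Y form a subgroup, which contains the support of mu; a
    translate of a path in F then reaches y. *)
Lemma orbit_walk1 y : Y y -> walk A E Y 1%g y.
Proof.
have [G1 GV GM] := sGam.
have wFY p : F p -> walk A E Y 1%g p.
  by move=> /wF; apply: walk_subset; exact: orbit_skeleton.
have wG : Gam `<=` [set g | Gam g /\ walk A E Y 1%g g].
  apply: generated_min => [|f Sf]; last first.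
    by split; [exact: msupp_Gamma|exact/wFY/SF].
  split=> /= [|g [Gg wg]|g h [Gg wg] [Gh wh]].
  - by split=> //; exact: walk_nil.
  - split; first exact: GV.
    apply: walk_sym => //; rewrite -(mulVg g) -[X in walk _ _ _ X _]mulg1.
    by apply: walk_mul => // z; apply: orbit_mul; exact: GV.
  - split; first exact: GM.
    apply: (walk_trans wg); rewrite -[X in walk _ _ _ X _]mulg1.
    by apply: walk_mul => // z; exact: orbit_mul.
move=> [g Gg [p Fp <-]]; have [_ wg] := wG _ Gg.
apply: (walk_trans wg); rewrite -[X in walk _ _ _ X _]mulg1.
by apply: walk_mul; [move=> z; exact: orbit_mul|exact: wFY].
Qed.

Lemma orbit_walk x y : Y x -> Y y -> walk A E Y x y.
Proof.
by move=> Yx Yy; apply: (walk_trans (walk_sym sA sE (orbit_walk1 Yx)));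
  exact: orbit_walk1.
Qed.

Lemma finA : finite_set (transitions Gam F A).
Proof.
apply: finite_transitions => // g p Gg h.
by apply: (Gamma_conj_trivial Gg); left; exact: h.
Qed.

Lemma finE : finite_set (transitions Gam F E).
Proof.
apply: finite_transitions => // g p Gg h.
by apply: (Gamma_conj_trivial Gg); right; exact: h.
Qed.

Variables (kap r c M : R).
Hypothesis r1 : 1 <= r.
Local Notation TA := (transitions Gam F A).
Local Notation TE := (transitions Gam F E).
Hypothesis stepEA : forall e a z, TE e -> ~ affine e -> TA a -> ~ elementary a ->
  vcone kap r z -> vcone kap r (a (e z)) /\ 2 * modulus z.2 <= modulus (a (e z)).2.
Hypothesis stepE : forall e z, TE e -> ~ affine e -> vcone kap r z ->
  modulus z.2 <= modulus (e z).1.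
Hypothesis cross : forall a z, TA a -> ~ elementary a -> ~ vcone kap r z ->
  ~ vcone kap r (a z) -> box c z.
Hypothesis bounded : forall a z p, TA a -> 0 <= p -> box p z ->
  modulus (a z).1 <= M * (p + 1).

(* [m y = 0] says that almost no z has its y-chart in the region from which
   leaving the vertex yA along the edge y makes the charts of z escape to
   infinity. *)
Local Notation m := (mass nu (vcone kap r)).
(** An edge of the tree is a class modulo the intersection of A and E, while the cone depends on the
    representative; asking for all representatives in Y makes [good] a property of the edge. *)
Let good y := forall x, Y x -> lcong A y x -> lcong E y x -> m x = 0.

(** Moving from x to y and on to w changes the chart by a nonaffine elementary map followed by a
    nonelementary affine one, the ping-pong pair of [stepEA]. *)
Lemma escape_step x y w z : Y x -> Y y -> Y w ->
  lcong E x y -> ~ lcong A x y -> lcong A y w -> ~ lcong E y w ->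
  vcone kap r ((x^-1)%g z) -> vcone kap r ((w^-1)%g z) /\
    2 * modulus ((x^-1)%g z).2 <= modulus ((w^-1)%g z).2.
Proof.
move=> Yx Yy Yw Exy Axy Ayw Eyw vz.
rewrite (chart_change y w) (chart_change x y); apply: stepEA => //.
- by apply: transitions_mem => //; exact: lcong_sym.
- by move=> /(lcong_sym sA).
- by apply: transitions_mem => //; exact: lcong_sym.
- by move=> /(lcong_sym sE).
Qed.

(** The second coordinate starts at least at 1 and doubles n - 1 times, up to the start x' of the
    last E-step; that step carries the bound over to the first coordinate. *)
Lemma escape x n y z : rpath A E Y x n y -> vcone kap r ((x^-1)%g z) ->
  2 ^+ n.-1 <= modulus ((y^-1)%g z).1.
Proof.
move=> xy vz.
have [x' [[Yx' Yy] Exy Axy vz' h]] : exists x', [/\ Y x' /\ Y y, lcong E x' y,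
    ~ lcong A x' y, vcone kap r ((x'^-1)%g z)
    & 2 ^+ n.-1 <= modulus ((x'^-1)%g z).2].
  elim: xy => [{}y Yx Yy Exy Axy|{}n w u v xw [x' [[Yx' Yw] Exw Axw vz' h]]].
    by exists x; split=> //; rewrite (le_trans r1) //; exact: vz.2.
  move=> Yu Yv Awu Ewu Euv Auv; exists u.
  have [v1 v2] := escape_step Yx' Yw Yu Exw Axw Awu Ewu vz'.
  split=> //; apply: le_trans v2.
  by case: n xw h => [|n] xw h; [inversion xw|rewrite exprS ler_pM2l].
apply: le_trans h _; rewrite (chart_change x' y); apply: stepE => //.
  by apply: transitions_mem => //; exact: lcong_sym.
by move=> /(lcong_sym sA).
Qed.

Lemma rpath_restart x x' n y : rpath A E Y x n y -> Y x' -> lcong A x x' ->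
  lcong E x x' -> rpath A E Y x' n y.
Proof.
move=> xy Yx' Axx Exx.
elim: xy => [{}y Yx Yy Exy Axy|{}n w u v _ IH Yu Yv Awu Ewu Euv Auv].
  apply: rpath_one => //.
    by apply: lcong_trans Exy => //; exact: lcong_sym.
  by move=> h; apply: Axy; exact: lcong_trans h.
exact: (rpath_step IH Yu Yv Awu).
Qed.

Lemma good_cong x y : good x -> lcong A x y -> lcong E x y -> good y.
Proof.
move=> gx Axy Exy z Yz Ayz Eyz.
by apply: gx => //; [exact: lcong_trans Ayz|exact: lcong_trans Eyz].
Qed.

Hypothesis infG : infinite_set Gam.

(* Some element far away in the orbit carries almost all the mass of nu in a fixed
   box; points escaping in its direction avoid that box. *)
Lemma good_exists y : Y y -> exists2 x, Y x /\ lcong A y x & good x.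
Proof.
move=> Yy; apply: contrapT => nogood.
have finAy := finite_lcong Yy finA.
pose V := [set x | (Y x /\ lcong A y x) /\ m x != 0].
have [d [d0 hd]] : exists d : R, 0 < d /\ forall x, V x -> d <= m x.
  have [||s hs] := @finite_uniform R _ V (fun x s => 0 < s /\ s^-1 <= m x).
  - by apply: sub_finite_set finAy => x [].
  - move=> x [_ mx]; have mx0 : 0 < m x by rewrite lt0r mx mass_ge0.
    exists (m x)^-1 => s ms.
    have s0 : 0 < s by apply: lt_le_trans ms; rewrite invr_gt0.
    by split=> //; rewrite -[leRHS]invrK lef_pV2 ?posrE ?invr_gt0.
  pose s' := Num.max s 1; exists s'^-1; split.
    by rewrite invr_gt0 lt_max ltr01 orbT.
  by move=> x Vx; apply: (hs x s' Vx _).2; rewrite le_max lexx.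
(* With e = d / 2 a cone of mass at least d cannot be disjoint from the box, as d + (1 - d / 2) >
   1. *)
have [p p0 infT] := infinite_mass mu_fin nu_stat infG (divr_gt0 d0 (ltr0n R 2)).
set T := mkset _ in infT.
(* After more than N steps, 2^(n-1) exceeds the first coordinate that an affine transition can give
   to a point of the box. *)
pose N := Num.bound (M * (p + 1)).
have TY : T `<=` Y by move=> g [Gg _]; exact: orbit_Gamma.
have [t [x [n [w [[Gt mt] Nn Ayx xw Awt]]]]] :=
  long_rpath sA sE (fun y Yy => finite_lcong Yy finA)
   (fun y Yy => finite_lcong Yy finE) N.+1 Yy TY (fun t => @orbit_walk y t Yy) infT.
have Yx := rpath_start xw; have Yw := rpath_end xw.
apply: nogood; exists x => // x' Yx' Axx Exx; apply/eqP/negPn/negP => mx'.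
have dx' : d <= m x' by apply: hd; split=> //; split=> //; exact: lcong_trans Axx.
have xw' := rpath_restart xw Yx' Axx Exx.
pose P := (x'^-1)%g @^-1` vcone kap r; pose Q := (t^-1)%g @^-1` box p.
have mP : measurable (P : set (borel_plane R)).
  by apply: closed_polyaut_measurable; exact: vcone_closed.
have mQ : measurable (Q : set (borel_plane R)).
  by apply: closed_polyaut_measurable; exact: box_closed.
have PQ : P `&` Q = set0.
  rewrite -subset0 => z [Pz Qz].
  have h1 := escape xw' Pz.
  have h2 : modulus ((w^-1)%g z).1 <= M * (p + 1).
    rewrite (chart_change t w); apply: bounded => //.
    by apply: transitions_mem => //; exact: orbit_Gamma.
  have h3 : M * (p + 1) < 2 ^+ n.-1.
    by apply: upper_nthrootP; rewrite -ltnS prednK // (leq_trans _ Nn).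
  by have := lt_le_trans h3 (le_trans h1 h2); rewrite ltxx.
have : (nu (P `|` Q) <= 1)%E by apply: probability_le1; exact: measurableU.
have eP : nu P = (m x')%:E by apply: massE; exact: vcone_closed.
have eQ : nu Q = (mass nu (box p) t)%:E by apply: massE; exact: box_closed.
have -> : nu (P `|` Q) = ((m x')%:E + (mass nu (box p) t)%:E)%E.
  by rewrite -eP -eQ; exact: measureU.
rewrite -EFinD lee_fin => h.
by have : d + (1 - d / 2) <= 1 by [apply: le_trans h; exact: lerD]; lra.
Qed.

(** If y is not good, the good edge w at yA differs from y, so the path from x through y to w does
    not backtrack. The cone at x then lies in the null cone at w. *)
Lemma good_or x y : Y x -> Y y -> lcong E x y -> ~ lcong A x y -> good x \/ good y.
Proof.
move=> Yx Yy Exy Axy; have [|ngy] := pselect (good y); first by right.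
left=> x' Yx' Axx Exx; have [w [Yw Ayw] gw] := good_exists Yy.
have nEyw : ~ lcong E y w.
  by move=> Eyw; apply: ngy; apply: (good_cong gw); exact: lcong_sym.
have mw : m w = 0 by apply: gw => //; exact: lcong_refl.
apply/eqP; rewrite eq_le mass_ge0 andbT -mw; apply: mass_le.
  exact: vcone_closed.
move=> z vz; apply: (escape_step Yx' Yy Yw _ _ Ayw nEyw vz).1.
  by apply: lcong_trans Exy => //; exact: lcong_sym.
by move=> h; apply: Axy; exact: lcong_trans h.
Qed.

(** A zero of the nonnegative harmonic function m propagates to its translates by inverses of
    atoms. *)
Lemma good_supp f y : msupp mu f -> Y y -> good y -> good (f^-1 * y)%g.
Proof.
move=> Sf Yy gy x Yx; rewrite -{1 2 3}(mulKg f x) !lcong_mul => Ax Ex.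
apply: (mass_eq0 mu_fin nu_stat (@vcone_closed R kap r) _ Sf).
by apply: gy => //; apply: orbit_mul => //; exact: msupp_Gamma.
Qed.

(** By [cross], a point outside the box in the chart of x lies in the cone at x or in the cone at y,
    both null; so the support lies in the compact translate of the box by x. *)
Lemma compact_of_null x y : Y x -> Y y -> lcong A x y -> ~ lcong E x y ->
  m x = 0 -> m y = 0 -> compactly_supported nu.
Proof.
move=> Yx Yy Axy Exy mx my.
apply: (@subclosed_compact _ (measure_support nu) _ support_closed
  (@preimage_box_compact R x c)).
move=> z sz; apply: contrapT => nz.
pose K := (x^-1)%g @^-1` box c.
have cK : closed K.
  by apply: preimage_closed (@box_closed R c) => w _; exact: polyaut_continuous.
have := sz _ (closed_openC cK) nz; rewrite ltNge => /negP; apply.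
pose P g := (g^-1)%g @^-1` vcone kap r : set (borel_plane R).
have mP g : measurable (P g).
  by apply: closed_polyaut_measurable; exact: vcone_closed.
have sub : ~` K `<=` P x `|` P y.
  move=> w nKw; apply: contrapT => nP; apply: nKw.
  apply: (cross (a := (y^-1 * x)%g)).
  - by apply: transitions_mem => //; exact: lcong_sym.
  - by move=> /(lcong_sym sE).
  - by move=> h; apply: nP; left.
  - by rewrite -chart_change => h; apply: nP; right.
have -> : (0 = nu (P x) + nu (P y))%E.
  by rewrite !massE ?mx ?my ?adde0 //; exact: vcone_closed.
apply: le_trans (measureU2 _ (mP x) (mP y)).
apply: le_measure => //; apply: mem_set; last exact: measurableU.
by apply: measurableC; apply: closed_polyaut_measurable; exact: box_closed.
Qed.

Hypothesis noncompact : ~ compactly_supported nu.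

Lemma good_unique x y : Y x -> Y y -> lcong A x y -> good x -> good y ->
  lcong E x y.
Proof.
move=> Yx Yy Axy gx gy; apply: contrapT => Exy; apply: noncompact.
by apply: (compact_of_null Yx Yy) => //; [apply: gx|apply: gy] => //;
  exact: lcong_refl.
Qed.

(** For an atom f, [good_supp] handles translation by f^-1. Conversely, if u is good, f^-1 carries a
    good edge at the A-vertex of f u to a good edge at uA, which by uniqueness is the edge u. *)
Lemma good_Gamma g y : Gam g -> Y y -> good (g * y)%g <-> good y.
Proof.
have [G1 GV GM] := sGam.
pose H := [set g | Gam g /\ forall y, Y y -> good (g * y)%g <-> good y].
have GH : Gam `<=` H.
  apply: generated_min => [|f Sf].
    split=> [|h [Gh Hh]|h k [Gh Hh] [Gk Hk]].
    - by split=> // u _; rewrite mul1g.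
    - split; first exact: GV.
      move=> u Yu; rewrite -[X in _ <-> good X](mulVKg h) Hh //.
      by apply: orbit_mul => //; exact: GV.
    - split; first exact: GM.
      by move=> u Yu; rewrite -mulgA Hh ?Hk //; exact: orbit_mul.
  have Gf := msupp_Gamma Sf; have Gf' := GV _ Gf.
  split=> // u Yu; have Yfu := orbit_mul Gf Yu.
  split=> [/(good_supp Sf Yfu)|gu]; first by rewrite mulKg.
  have [w [Yw Aw] gw] := good_exists Yfu.
  have Afw : lcong A u (f^-1 * w)%g by rewrite -(lcong_mul _ f) mulVKg.
  have Efw : lcong E (f * u)%g w.
    rewrite -(lcong_mul _ f^-1%g) mulKg.
    by apply: good_unique => //; [exact: orbit_mul|exact: good_supp].
  by apply: (good_cong gw); exact: lcong_sym.
by move=> Gg; exact: (GH g Gg).2.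
Qed.

Lemma Gamma_commute a b : Gam a -> Gam b -> (a * b = b * a)%g.
Proof.
have [G1 _ _] := sGam.
apply: (@flow_commute _ A E Gam Y good) => //.
- exact: orbit_Gamma.
- exact: orbit_mul.
- move=> g y Gg h; apply: (@Gamma_conj_trivial g y Gg).
  by rewrite -!mulgA.
- exact: orbit_walk1.
- exact: good_exists.
- exact: good_unique.
- exact: good_Gamma.
- exact: good_or.
Qed.

End Orbit.

End Recurrence.
Theorem theorem1p1 (R : realType) (mu : polyaut R -> R)
    (mu_fin : finitely_supported_probability mu)
    (mu_ne : non_elementary mu)
    (mu_lox : purely_loxodromic mu)
    (nu : probability (borel_plane R) R)
    (nu_stat : stationary mu nu) :
  compactly_supported nu.
Proof.
have [f [g [Gf Gg _ _ [a [b [eab fab]]]]]] := mu_ne.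
have sG := generated_is_subgroup (msupp mu).
have sub : generated [set a; b] `<=` Gamma mu.
  by rewrite -eab; apply: generated_min => // x [->|->].
have [Ga Gb] : Gamma mu a /\ Gamma mu b.
  by split; apply: sub => H [_]; apply; [left|right].
have [F [fF F1 SF wF]] := finite_skeleton mu_fin.
have [kap [r [c [M [r1 h1 h2 h3 h4]]]]] := pingpong_constants
  (finA mu_lox fF) (finE mu_lox fF) (fun a => @proj1 _ _) (fun a => @proj1 _ _).
apply: contrapT => nc; apply: (free_pair_noncommuting fab).
by apply: (Gamma_commute mu_fin mu_lox nu_stat fF F1 SF wF r1 h1 h2 h3 h4
  (free_pair_infinite fab sG Ga) nc).
Qed.
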